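(* Let $X=X_\Delta$ be a smooth complete toric surface and let $\mathcal{E}$ be an equivariant vector bundle of rank $2$ over $X$ determined by filtrations $(i^\rho_1,i^\rho_2,E^\rho)$, $\rho\in\Delta(1)$. Assume that $i^\rho_1<i^\rho_2$ for all $\rho\in\Delta(1)$ and that $E^\rho\neq E^{\rho'}$ whenever $\rho\neq\rho'$ are rays for which there is a $\sigma\in\Delta(2)$ with $\rho,\rho'\in\sigma(1)$. Then, possibly after replacing $\mathcal{E}$ by its twist by an equivariant line bundle, there exists an equivariant short exact sequence $$0\longrightarrow\mathcal{O}^{n-2}\overset{A}{\longrightarrow}\bigoplus_{\rho\in\Delta(1)}\mathcal{O}(i^\rho\cdot D_\rho)\longrightarrow\mathcal{E}\longrightarrow0,$$ where $n=\#\Delta(1)$, $i^\rho>0$ are integers, and $A$ is an $n\times(n-2)$-matrix of monomials (each entry is a scalar in $k$, possibly zero, times a monomial of the homogeneous coordinate ring $S=k[x_\rho\mid\rho\in\Delta(1)]$).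
   Context: Toric notation: $k$ is an algebraically closed field, $N$ a lattice (here of rank $2$), $M=\operatorname{Hom}(N,\mathbb{Z})$ with pairing $\langle\,,\rangle$, $T=\operatorname{Hom}(M,k^* )$, $\Delta$ a fan in $N_{\mathbb{R}}$, $\Delta(i)$ its set of $i$-dimensional cones (elements of $\Delta(1)$ are rays), $\sigma(1)$ the set of rays of $\sigma$, $n(\rho)$ the primitive lattice vector of the ray $\rho$, $D_\rho$ the $T$-invariant prime divisor of $\rho$, $\sigma_M=\check\sigma\cap M$, $U_\sigma=\operatorname{Spec}k[\sigma_M]$, $k[\sigma_M]=\bigoplus_{m\in\sigma_M}k\chi(m)$. Equivariant means $T$-linearized in the sense of geometric invariant theory, and an equivariant sequence is one whose maps are compatible with the linearizations. For an equivariant quasicoherent sheaf $\mathcal{E}$, $\Gamma(U_\sigma,\mathcal{E})=\bigoplus_{m\in M}\Gamma(U_\sigma,\mathcal{E})_m$ is the isotypical decomposition, normalized so that it makes $\Gamma(U_\sigma,\mathcal{E})$ an $M$-graded $k[\sigma_M]$-module, $\chi(m)$ having degree $m$. Homogeneous coordinates: $S$ is graded by $\mathbb{Z}^{\Delta(1)}$, $x_\rho$ having as degree the standard basis vector of $\rho$. For $\underline n\in\mathbb{Z}^{\Delta(1)}$, $S(\underline n)$ is the shift $S(\underline n)_{\underline n'}=S_{\underline n+\underline n'}$. A $\mathbb{Z}^{\Delta(1)}$-graded $S$-module $F$ gives an equivariant sheaf $\tilde F$ on $X$ with $\Gamma(U_\sigma,\tilde F)_m=(F_{x^{\hat\sigma}})_{j(m)}$,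 where $x^{\hat\sigma}=\prod_{\rho\notin\sigma(1)}x_\rho$ and $j(m)=(\langle m,n(\rho)\rangle)_\rho$. For $D=\sum_\rho n_\rho D_\rho$, $\mathcal{O}(D)=\widetilde{S(\underline n)}$ carries this equivariant structure, as does $\mathcal{O}=\tilde S$. A matrix of monomials homogeneous with respect to the grading defines a homogeneous map of free modules and hence an equivariant map of sheaves, again denoted $A$. Filtrations: let $\mathbf{E}^0$ be the direct limit of the spaces $\Gamma(T,\mathcal{E})_m$, $m\in M$, under the isomorphisms given by multiplication with characters; it is a vector space of dimension equal to the rank $2$. For $\rho\in\Delta(1)$, restriction to $T$ identifies $\Gamma(U_\rho,\mathcal{E})_m$ with a subspace of $\mathbf{E}^0$ depending only on $i=\langle m,n(\rho)\rangle$, denoted $E^\rho(i)$; these form an increasing full filtration of $\mathbf{E}^0$ ($E^\rho(i)=0$ for $i\ll0$ and $E^\rho(i)=\mathbf{E}^0$ for $i\gg0$). The integers $i^\rho_1\leq i^\rho_2$ are determined by $0=\dim E^\rho(i^\rho_1-1)<\dim E^\rho(i^\rho_1)$ and $\dim E^\rho(i^\rho_2-1)<\dim E^\rho(i^\rho_2)=2$. If $i^\rho_1<i^\rho_2$, then $E^\rho\subset\mathbf{E}^0$ is the $1$-dimensional subspace with $E^\rho(i)=E^\rho$ for $i^\rho_1\leq i<i^\rho_2$. The filtration is written $(i^\rho_1,i^\rho_2,E^\rho)$. Every equivariant rank $2$ bundle on $X$ is determined by these filtrations. *)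

(* Defs.v *)
From HB Require Import structures.
From mathcomp Require Import all_boot all_order all_algebra.
From mathcomp Require Import boolp reals.
From mathcomp Require Import mpoly.
From mathcomp Require Import zify.

Set Implicit Arguments.
Unset Strict Implicit.
Unset Printing Implicit Defensive.

Import Order.TTheory GRing.Theory Num.Theory.
Local Open Scope ring_scope.

(* A basis of the lattice N is fixed: N = Z^d and M = Hom(N, Z) = Z^d are both
   'rV[int]_d, paired by the dot product. *)

Definition pairing (A : pzRingType) d (m v : 'rV[A]_d) : A :=
  \sum_i m 0 i * v 0 i.

Section ConesAndFaces.
Variables (R : realType) (d : nat).

Definition toR (v : 'rV[int]_d) : 'rV[R]_d := map_mx intr v.

(* With a = 0 this also excludes v = 0. *)
Definition primitive (v : 'rV[int]_d) : Prop :=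
  forall (a : int) (w : 'rV[int]_d), v = a *: w -> `|a| = 1.

Definition hull (I : finType) (gen : I -> 'rV[int]_d) (s : {set I})
    (x : 'rV[R]_d) : Prop :=
  exists c : I -> R,
    (forall i, 0 <= c i) /\ x = \sum_(i in s) c i *: toR (gen i).

(* The cones below are rational, so their faces are cut out by functionals
   which belong to M. *)
Definition is_face (F C : 'rV[R]_d -> Prop) : Prop :=
  exists u : 'rV[int]_d, (forall x, C x -> 0 <= pairing (toR u) x) /\
    (forall x, F x <-> C x /\ pairing (toR u) x = 0).

(* [ray] is Delta(1), [gen] is rho |-> n(rho), and a cone sigma of the fan is
   encoded by the set sigma(1) of its rays; as a subset of N_R it is
   [hull gen sigma]. *)
Record fan := Fan {
  ray : finType;
  gen : ray -> 'rV[int]_d;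
  cones : {set {set ray}};
  gen_primitive : forall r, primitive (gen r);
  gen_inj : injective gen;
  zero_in_cones : set0 \in cones;
  ray_in_cones : forall r, [set r] \in cones;
  cones_pointed : forall s x, s \in cones ->
    hull gen s x -> hull gen s (- x) -> x = 0;
  cones_rays : forall s r, s \in cones -> r \in s ->
    is_face (hull gen [set r]) (hull gen s);
  cones_faces : forall s F, s \in cones -> is_face F (hull gen s) ->
    exists2 t, t \in cones & forall x, F x <-> hull gen t x;
  cones_meet : forall s t, s \in cones -> t \in cones ->
    is_face (fun x => hull gen s x /\ hull gen t x) (hull gen s)
}.

Definition cone_dim (D : fan) (s : {set ray D}) : nat :=
  \rank (\sum_(r in s) <<toR (gen r)>>)%MS.

Definition cones_of_dim (D : fan) (i : nat) : {set {set ray D}} :=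
  [set s in cones D | cone_dim s == i].

(* X_Delta is smooth iff each cone is generated by part of a basis of N. *)
Definition smooth (D : fan) : Prop :=
  forall s, s \in cones D -> exists2 B : 'M[int]_d, B \in unitmx &
    forall r, r \in s -> exists i, gen r = row i B.

(* X_Delta is complete iff the cones cover N_R. *)
Definition complete (D : fan) : Prop :=
  forall x : 'rV[R]_d, exists2 s, s \in cones D & hull (@gen D) s x.

Definition cone (D : fan) := {s : {set ray D} | s \in cones D}.
Definition zero_cone (D : fan) : cone D := Sub set0 (zero_in_cones D).
Definition ray_cone (D : fan) (r : ray D) : cone D :=
  Sub [set r] (ray_in_cones r).

(* m belongs to sigma_M; it is enough to test m on the rays of sigma. *)
Definition in_dual (D : fan) (s : {set ray D}) (m : 'rV[int]_d) : bool :=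
  [forall r in s, 0 <= pairing m (gen r)].

End ConesAndFaces.

Section FanFacts.
Variables (R : realType) (d : nat).

Lemma pairingDl (A : pzRingType) (m m' v : 'rV[A]_d) :
  pairing (m + m') v = pairing m v + pairing m' v.
Proof. by rewrite -big_split; apply: eq_bigr => i _; rewrite mxE mulrDl. Qed.

Lemma pairingZl (A : pzRingType) a (m v : 'rV[A]_d) :
  pairing (a *: m) v = a * pairing m v.
Proof. by rewrite mulr_sumr; apply: eq_bigr => i _; rewrite mxE mulrA. Qed.

Lemma pairing0l (A : pzRingType) (v : 'rV[A]_d) : pairing 0 v = 0.
Proof. by apply: big1 => i _; rewrite mxE mul0r. Qed.

Lemma pairingNl (A : pzRingType) (m v : 'rV[A]_d) :
  pairing (- m) v = - pairing m v.
Proof. by rewrite -sumrN; apply: eq_bigr => i _; rewrite mxE mulNr. Qed.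

Lemma pairing0r (A : pzRingType) (m : 'rV[A]_d) : pairing m 0 = 0.
Proof. by apply: big1 => i _; rewrite mxE mulr0. Qed.

Lemma pairingZr (A : comPzRingType) a (m v : 'rV[A]_d) :
  pairing m (a *: v) = a * pairing m v.
Proof. by rewrite mulr_sumr; apply: eq_bigr => i _; rewrite mxE mulrCA. Qed.

Lemma pairing_sumr (A : pzRingType) (I : Type) (s : seq I) (P : pred I) m
    (f : I -> 'rV[A]_d) :
  pairing m (\sum_(i <- s | P i) f i) = \sum_(i <- s | P i) pairing m (f i).
Proof.
rewrite exchange_big; apply: eq_bigr => i _.
by rewrite summxE mulr_sumr.
Qed.

Lemma pairing_toR (m v : 'rV[int]_d) :
  pairing (toR R m) (toR R v) = (pairing m v)%:~R.
Proof.
by rewrite rmorph_sum; apply: eq_bigr => i _; rewrite !mxE -rmorphM.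
Qed.

Lemma toR_inj : injective (@toR R d).
Proof.
move=> v w /matrixP e; apply/matrixP => i j.
by have := e i j; rewrite !mxE => /eqP; rewrite eqr_int => /eqP.
Qed.

Lemma primitive_neq0 (v : 'rV[int]_d) : primitive v -> v != 0.
Proof.
move=> pv; apply/eqP => v0.
by have := pv 0 0; rewrite v0 scaler0 normr0 => /(_ erefl).
Qed.

Lemma primitive_pos_eq (v w : 'rV[int]_d) (c : R) :
  primitive v -> primitive w -> 0 <= c -> toR R w = c *: toR R v -> w = v.
Proof.
move=> pv pw c0 e.
have [i vi] : exists i, v 0 i != 0.
  apply/existsP; apply: contraTT (primitive_neq0 pv).
  rewrite negb_exists negbK => /forallP h; apply/eqP/rowP => i.
  by rewrite mxE; apply/eqP; rewrite -[_ == _]negbK.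
have ee j : (w 0 j)%:~R = c * (v 0 j)%:~R :> R.
  by have /rowP/(_ j) := e; rewrite !mxE.
have par : w 0 i *: v = v 0 i *: w.
  apply/rowP => j; rewrite !mxE; apply/eqP; rewrite -(eqr_int R) !rmorphM /= !ee.
  by apply/eqP; rewrite -!mulrA mulrCA.
pose h := gcdz (v 0 i) (w 0 i).
have h0 : h != 0 by rewrite gcdz_eq0 negb_and vi.
have [a ea] : exists a, v 0 i = a * h by exact/dvdzP/dvdz_gcdl.
have [b eb] : exists b, w 0 i = b * h by exact/dvdzP/dvdz_gcdr.
have [x [y exy]] := Bezoutz (v 0 i) (w 0 i).
have xy1 : x * a + y * b = 1.
  by apply: (mulIf h0); rewrite mul1r mulrDl -!mulrA -ea -eb exy.
have par' : b *: v = a *: w.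
  apply/rowP => j; apply: (mulfI h0); rewrite !mxE !mulrA ![h * _]mulrC.
  by rewrite -ea -eb; have /rowP/(_ j) := par; rewrite !mxE.
pose z := x *: v + y *: w.
have va : v = a *: z.
  rewrite scalerDr !scalerA [a * x]mulrC [a * y]mulrC -[(y * a) *: w]scalerA.
  by rewrite -par' scalerA -scalerDl xy1 scale1r.
have wb : w = b *: z.
  rewrite scalerDr !scalerA [b * x]mulrC [b * y]mulrC -[(x * b) *: v]scalerA.
  by rewrite par' scalerA -scalerDl xy1 scale1r.
clearbody z; have a1 := pv _ _ va; have b1 := pw _ _ wb.
suff: a = b by move=> ab; rewrite [LHS]wb [RHS]va ab.
have zi : z 0 i != 0.
  by apply: contraNneq vi => z0; rewrite [v]va mxE z0 mulr0.
have := ee i; rewrite [v]va [w]wb !mxE !rmorphM /= mulrA => /mulIf.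
rewrite intr_eq0 => /(_ zi) eab.
have : 0 <= b%:~R * a%:~R :> R by rewrite eab -mulrA mulr_ge0 // -expr2 sqr_ge0.
rewrite -rmorphM /= ler0z.
move: a1 b1; clear.
by case: (ger0P a) => _; case: (ger0P b) => _ ea eb; lia.
Qed.

Lemma in_hull (D : fan R d) (s : {set ray D}) r :
  r \in s -> hull (@gen _ _ D) s (toR R (gen r)).
Proof.
move=> rs; exists (fun i => (i == r)%:R); split; first by move=> i; apply: ler0n.
rewrite (bigD1 r) //= eqxx scale1r big1 ?addr0 // => i /andP[_ /negPf ->].
by rewrite scale0r.
Qed.

Lemma face_separation (D : fan R d) (s t : {set ray D}) :
  s \in cones D -> t \in cones D -> t \subset s ->
  exists u, [/\ in_dual s u,
    forall r, r \in t -> pairing u (gen r) = 0 &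
    forall r, r \in s -> r \notin t -> 0 < pairing u (gen r)].
Proof.
move=> sD tD /subsetP ts.
have [u [upos uface]] := cones_meet sD tD.
have us : in_dual s u.
  apply/forall_inP => r rs; have := upos _ (in_hull rs).
  by rewrite pairing_toR ler0z.
exists u; split=> // [r rt|r rs rt].
  have [+ _] := uface (toR R (gen r)).
  case; first by split; apply: in_hull => //; exact: ts.
  by move=> _; rewrite pairing_toR => /eqP; rewrite intr_eq0 => /eqP.
rewrite lt0r (forall_inP us) // andbT; apply/eqP => u0.
have [_ []] := uface (toR R (gen r)).
  by split; [exact: in_hull | rewrite pairing_toR u0].
move=> _ [c [c0 ec]].
have [w [wpos wface]] := cones_rays sD rs.
have wr : pairing (toR R w) (toR R (gen r)) = 0.
  by have [+ _] := wface (toR R (gen r)); case=> //; apply: in_hull; rewrite inE.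
have wt r' : r' \in t -> 0 < pairing (toR R w) (toR R (gen r')).
  move=> r't; rewrite lt0r wpos ?andbT; last by apply: in_hull; exact: ts.
  apply/eqP => w0.
  have [_ []] := wface (toR R (gen r')).
    by split=> //; apply: in_hull; exact: ts.
  move=> b [b0]; rewrite big_set1 => e.
  have e' := primitive_pos_eq (@gen_primitive _ _ D r) (@gen_primitive _ _ D r') (b0 r) e.
  by move: rt; rewrite -(gen_inj e') r't.
have c00 r' : r' \in t -> c r' = 0.
  move=> r't; move: wr; rewrite ec pairing_sumr => /eqP.
  rewrite psumr_eq0; last first.
    by move=> j jt; rewrite pairingZr mulr_ge0 // ltW // wt.
  move=> /allP /(_ r'); rewrite mem_index_enum => /(_ isT).
  by rewrite r't /= pairingZr mulf_eq0 (gt_eqF (wt _ r't)) orbF => /eqP.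
have : toR R (gen r) = toR R 0.
  rewrite ec big1; first by apply/rowP => i; rewrite !mxE.
  by move=> j jt; rewrite c00 // scale0r.
by move/toR_inj/eqP; apply/negP/primitive_neq0/gen_primitive.
Qed.

Lemma in_dual0 (D : fan R d) m : in_dual (set0 : {set ray D}) m.
Proof. by apply/forall_inP => r; rewrite inE. Qed.

Lemma in_dualS (D : fan R d) (s t : {set ray D}) m :
  t \subset s -> in_dual s m -> in_dual t m.
Proof.
by move=> /subsetP ts /forall_inP h; apply/forall_inP => r /ts; exact: h.
Qed.

Lemma zero_cone_sub (D : fan R d) (s : cone D) :
  val (zero_cone D) \subset val s.
Proof. exact: sub0set. Qed.

End FanFacts.

Section GradedModules.
Variables (R : realType) (d : nat) (D : fan R d) (k : fieldType).
Variable (s : {set ray D}).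

(* M-graded k[sigma_M]-modules, given by their homogeneous components and the
   multiplications by chi(m' - m) for m' - m in sigma_M. *)
Record gmodule := GModule {
  gcomp :> 'rV[int]_d -> lmodType k;
  gmul : forall m m', in_dual s (m' - m) -> {linear gcomp m -> gcomp m'};
  gmul_id : forall m (h : in_dual s (m - m)) x, gmul h x = x;
  gmul_comp : forall m m' m'' (h : in_dual s (m' - m))
    (h' : in_dual s (m'' - m')) (h'' : in_dual s (m'' - m)) x,
    gmul h' (gmul h x) = gmul h'' x
}.

Arguments gmul {g m m'}.

Record ghom (P Q : gmodule) := GHom {
  hom_fun :> forall m, {linear P m -> Q m};
  hom_mul : forall m m' (h : in_dual s (m' - m)) x,
    hom_fun m' (gmul h x) = gmul h (hom_fun m x)
}.

Record gbilin (P Q W : gmodule) := GBilin {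
  bil_fun :> forall m n, P m -> Q n -> W (m + n);
  bil_linl : forall m n y, linear (fun x => bil_fun (m := m) (n := n) x y);
  bil_linr : forall m n x, linear (bil_fun (m := m) (n := n) x);
  bil_mull : forall m m' n (h : in_dual s (m' - m))
    (h' : in_dual s (m' + n - (m + n))) x (y : Q n),
    bil_fun (gmul h x) y = gmul h' (bil_fun x y);
  bil_mulr : forall m n n' (h : in_dual s (n' - n))
    (h' : in_dual s (m + n' - (m + n))) (x : P m) y,
    bil_fun x (gmul h y) = gmul h' (bil_fun x y)
}.

(* W, with the pairing b, is the tensor product of P and Q over k[sigma_M]. *)
Definition is_tensor_product (P Q W : gmodule) (b : gbilin P Q W) : Prop :=
  forall (V : gmodule) (c : gbilin P Q V),
    exists h : ghom W V,
      (forall m n (x : P m) (y : Q n), h _ (b _ _ x y) = c _ _ x y) /\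
      (forall h' : ghom W V,
         (forall m n (x : P m) (y : Q n), h' _ (b _ _ x y) = c _ _ x y) ->
         forall m w, h' m w = h m w).

(* Elements of k[M], as lists of terms (a, m) standing for a chi(m). *)
Definition kpoly := seq (k * 'rV[int]_d).

Definition kcoef (f : kpoly) (m : 'rV[int]_d) : k :=
  \sum_(t <- f | t.2 == m) t.1.

Definition kmul (f g : kpoly) : kpoly :=
  [seq (a.1 * b.1, a.2 + b.2) | a <- f, b <- g].

Definition in_kdual (f : kpoly) : bool := all (fun t => in_dual s t.2) f.

(* The elements of P itself, the direct sum of the P_m, are the total p with
   fin_supp p. *)
Definition total (P : gmodule) := forall m, P m.

Definition fin_supp (P : gmodule) (p : total P) : Prop :=
  exists l : seq 'rV[int]_d, forall m, m \notin l -> p m = 0.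

(* Multiplication by chi(m' - m); it is only used for m' - m in sigma_M. *)
Definition gmul_dflt (P : gmodule) (m m' : 'rV[int]_d) (x : P m) : P m' :=
  if @idP (in_dual s (m' - m)) is ReflectT h then gmul h x else 0.

Definition kact (P : gmodule) (f : kpoly) (p : total P) : total P :=
  fun m => \sum_(t <- f) t.1 *: gmul_dflt m (p (m - t.2)).

(* The localization P_f is free of rank n over k[sigma_M]_f. After scaling by
   powers of f, the elements of a basis come from P. *)
Definition free_on (n : nat) (P : gmodule) (f : kpoly) : Prop :=
  exists p : 'I_n -> total P,
    [/\ forall i, fin_supp (p i),
        forall q : total P, fin_supp q ->
          exists (N : nat) (a : 'I_n -> kpoly), (forall i, in_kdual (a i)) /\
            forall m, iter N (kact f) q m = \sum_i kact (a i) (p i) m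
      & forall a : 'I_n -> kpoly, (forall i, in_kdual (a i)) ->
          (forall m, \sum_i kact (a i) (p i) m = 0) ->
          exists N : nat, forall i m, kcoef (iter N (kmul f) (a i)) m = 0].

(* P, without its grading, is locally free of rank n: Spec k[sigma_M] is
   covered by open sets f <> 0 on which P is free of rank n, the covering
   being expressed by an equation sum g f = 1. *)
Definition locally_free (n : nat) (P : gmodule) : Prop :=
  exists l : seq (kpoly * kpoly),
    [/\ forall gf, gf \in l -> in_kdual gf.1 /\ in_kdual gf.2,
        forall m, kcoef (flatten [seq kmul gf.1 gf.2 | gf <- l]) m =
                  (m == 0)%:R
      & forall gf, gf \in l -> free_on n P gf.2].

End GradedModules.

Arguments gmul {R d D k s g m m'}.

Section EquivariantSheaves.
Variables (R : realType) (d : nat) (D : fan R d) (k : fieldType).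
Implicit Types (s t u : cone D) (m : 'rV[int]_d).

(* Equivariant quasicoherent sheaves on X_Delta. A quasicoherent sheaf amounts
   to modules of sections on the affine charts U_sigma, compatible with
   localization; a linearization amounts to the isotypical decomposition of
   these modules, that is to gradings by M. So the data are graded modules of
   sections on the U_sigma, with restrictions to the U_tau for the faces tau of
   sigma. The last two axioms say that the sections on U_tau are the
   localization of those on U_sigma at the chi(m), m in sigma_M orthogonal to
   tau; indeed k[tau_M] is that localization of k[sigma_M]. *)
Record eqsheaf := EqSheaf {
  sections :> forall s, gmodule k (val s);
  res : forall s t, val t \subset val s ->
    forall m, {linear sections s m -> sections t m};
  res_id : forall s (h : val s \subset val s) m x, res h m x = x;
  res_comp : forall s t u (h : val t \subset val s) (h' : val u \subset val t)
    (h'' : val u \subset val s) m x, res h' m (res h m x) = res h'' m x;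
  res_mul : forall s t (h : val t \subset val s) m m'
    (g : in_dual (val s) (m' - m)) (g' : in_dual (val t) (m' - m)) x,
    res h m' (gmul g x) = gmul g' (res h m x);
  res_ker : forall s t (h : val t \subset val s) m (x : sections s m),
    res h m x = 0 ->
    exists m' (g : in_dual (val s) (m' - m)),
      (forall r, r \in val t -> pairing (m' - m) (gen r) = 0) /\
      gmul g x = 0;
  res_loc : forall s t (h : val t \subset val s) m (y : sections t m),
    exists m' (g : in_dual (val s) (m' - m)) (g' : in_dual (val t) (m' - m)),
      (forall r, r \in val t -> pairing (m' - m) (gen r) = 0) /\
      exists x : sections s m', res h m' x = gmul g' y
}.

Arguments res {e s t}.

Record eqmap (E F : eqsheaf) := EqMap {
  map_sections :> forall s, ghom (E s) (F s);
  map_res : forall s t (h : val t \subset val s) m (x : E s m),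
    map_sections t m (res h m x) = res h m (map_sections s m x)
}.

(* Exactness is tested on the affine open sets U_sigma, degree by degree. *)
Definition short_exact (E F G : eqsheaf) (f : eqmap E F) (g : eqmap F G) :
    Prop :=
  forall s m,
    [/\ forall x, f s m x = 0 -> x = 0,
        forall y, g s m y = 0 <-> exists x, f s m x = y
      & forall z, exists y, g s m y = z].

Definition vector_bundle (n : nat) (E : eqsheaf) : Prop :=
  forall s, locally_free n (E s).

Definition line_bundle (E : eqsheaf) : Prop := vector_bundle 1 E.

(* The tensor product of quasicoherent sheaves is that of the modules of
   sections on each U_sigma. *)
Definition is_tensor (E L F : eqsheaf) : Prop :=
  exists b : forall s, gbilin (E s) (L s) (F s),
    (forall s, is_tensor_product (b s)) /\
    (forall s t (h : val t \subset val s) m n (x : E s m) (y : L s n),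
       res h _ (b s _ _ x y) = b t _ _ (res h _ x) (res h _ y)).

Definition is_twist (E F : eqsheaf) : Prop :=
  exists2 L : eqsheaf, line_bundle L & is_tensor E L F.

End EquivariantSheaves.

Arguments res {R d D k e s t}.

Section Filtrations.
Variables (R : realType) (d : nat) (D : fan R d) (k : fieldType).

Definition has_dim (V : lmodType k) (W : V -> Prop) (n : nat) : Prop :=
  exists b : 'I_n -> V,
    (forall c : 'I_n -> k, \sum_i c i *: b i = 0 -> forall i, c i = 0) /\
    (forall v, W v <-> exists c : 'I_n -> k, v = \sum_i c i *: b i).

Variable E : eqsheaf D k.

(* T is U_sigma for the zero cone. As the transition maps are isomorphisms, the
   direct limit of the Gamma(T, E)_m is Gamma(T, E)_0, the canonical map from
   Gamma(T, E)_m being the multiplication by chi(- m). *)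
Definition limit_space : lmodType k := E (zero_cone D) 0.

Definition to_limit m : {linear E (zero_cone D) m -> limit_space} :=
  gmul (in_dual0 D (0 - m)).

(* E^rho(i), as a subset of limit_space. *)
Definition filtration (r : ray D) (i : int) (v : limit_space) : Prop :=
  exists m (x : E (ray_cone r) m), pairing m (gen r) = i /\
    v = to_limit m (res (zero_cone_sub (ray_cone r)) m x).

(* The filtration of rho is (i1, i2, L) in the notation for rank 2 bundles. *)
Definition filtration_is (r : ray D) (i1 i2 : int) (L : limit_space -> Prop) :
    Prop :=
  [/\ has_dim (filtration r (i1 - 1)) 0
        /\ (exists2 n, (0 < n)%N & has_dim (filtration r i1) n),
      (exists2 n, (n < 2)%N & has_dim (filtration r (i2 - 1)) n)
        /\ has_dim (filtration r i2) 2
    & i1 < i2 -> has_dim L 1 /\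
        (forall i, i1 <= i < i2 -> forall v, filtration r i v <-> L v)].

End Filtrations.

(* Frac k[x_1, ..., x_n] as a vector space over k. *)
Section RationalFunctions.
Variables (k : fieldType) (n : nat).

Definition ratfun := {fraction {mpoly k[n]}}.
HB.instance Definition _ := GRing.Field.on ratfun.

Definition ratfun_poly (p : {mpoly k[n]}) : ratfun := FracField.tofrac p.
HB.instance Definition _ := GRing.RMorphism.copy ratfun_poly
  (@FracField.tofrac {mpoly k[n]}).

Definition ratfun_scale (c : k) (q : ratfun) : ratfun := ratfun_poly c%:MP * q.

Fact ratfun_scaleA a b q :
  ratfun_scale a (ratfun_scale b q) = ratfun_scale (a * b) q.
Proof. by rewrite /ratfun_scale mulrA -rmorphM -mpolyCM. Qed.

Fact ratfun_scale1 : left_id 1 ratfun_scale.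
Proof. by move=> q; rewrite /ratfun_scale mpolyC1 rmorph1 mul1r. Qed.

Fact ratfun_scaleDr : right_distributive ratfun_scale +%R.
Proof. by move=> a p q; rewrite /ratfun_scale mulrDr. Qed.

Fact ratfun_scaleDl q : {morph ratfun_scale^~ q : a b / a + b}.
Proof. by move=> a b; rewrite /ratfun_scale mpolyCD rmorphD mulrDl. Qed.

HB.instance Definition _ := GRing.Zmodule_isLmodule.Build k ratfun
  ratfun_scaleA ratfun_scale1 ratfun_scaleDr ratfun_scaleDl.

Lemma ratfun_scaleE (c : k) (q : ratfun) : c *: q = ratfun_poly c%:MP * q.
Proof. by []. Qed.

End RationalFunctions.

Section HomogeneousCoordinates.
Variables (R : realType) (d : nat) (D : fan R d) (k : fieldType).
Local Notation hring := {mpoly k[#|ray D|]}.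
Local Notation degree := {ffun ray D -> int}.
Implicit Types (s t : {set ray D}) (e : degree).

(* The homogeneous coordinate ring S is the polynomial ring hring with x_rho =
   hcoord rho; its grading group is Z^Delta(1) = degree. *)
Definition hcoord (r : ray D) : hring := 'X_(enum_rank r).

Definition mon_degree (a : 'X_{1..#|ray D|}) : degree :=
  [ffun r => (a (enum_rank r))%:Z].

Definition homogeneous e (p : hring) : bool :=
  all (fun a => mon_degree a == e) (msupp p).

Definition is_monomial (p : hring) : Prop :=
  exists (c : k) (a : 'X_{1..#|ray D|}), p = c *: 'X_[a].

Definition pair_degree (m : 'rV[int]_d) : degree :=
  [ffun r => pairing m (gen r)].

Definition hat_degree s : degree := [ffun r => (r \notin s)%:Z].

Definition hat_monomial s : hring := \prod_(r | r \notin s) hcoord r.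

(* q lies in the part of degree e of the localization of S at the product of
   the x_rho, rho not in sigma(1), regarded as a subring of Frac S. *)
Definition homog_loc s e (q : ratfun k #|ray D|) : Prop :=
  exists (N : nat) (p : hring), homogeneous (e + hat_degree s *+ N) p /\
    q = ratfun_poly p / ratfun_poly (hat_monomial s) ^+ N.

(* The Laurent monomial of exponent e. *)
Definition xpow e : ratfun k #|ray D| := \prod_r ratfun_poly (hcoord r) ^ (e r).

Lemma hcoord_neq0 r : ratfun_poly (hcoord r) != 0.
Proof.
rewrite /ratfun_poly tofrac_eq0; apply/eqP => /(congr1 (mcoeff U_(enum_rank r))).
by rewrite mcoeffXU eqxx mcoeff0 => /eqP; rewrite oner_eq0.
Qed.

Lemma xpow0 : xpow 0 = 1.
Proof. by apply: big1 => r _; rewrite ffunE expr0z. Qed.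

Lemma xpowD e f : xpow (e + f) = xpow e * xpow f.
Proof.
by rewrite -big_split; apply: eq_bigr => r _; rewrite ffunE expfzDr ?hcoord_neq0.
Qed.

Lemma xpow_neq0 e : xpow e != 0.
Proof. by apply/prodf_neq0 => r _; rewrite expfz_neq0 ?hcoord_neq0. Qed.

Lemma xpowN e : xpow (- e) = (xpow e)^-1.
Proof.
by apply: (mulfI (xpow_neq0 e)); rewrite -xpowD subrr xpow0 mulfV ?xpow_neq0.
Qed.

Lemma xpowMn e N : xpow (e *+ N) = xpow e ^+ N.
Proof. by elim: N => [|N IH]; rewrite ?xpow0 // mulrS xpowD IH exprS. Qed.

Lemma xpow_hat s : ratfun_poly (hat_monomial s) = xpow (hat_degree s).
Proof.
rewrite rmorph_prod /= big_mkcond; apply: eq_bigr => r _.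
by rewrite ffunE; case: (r \notin s); rewrite ?expr1z ?expr0z.
Qed.

Lemma homogeneousM e f p q :
  homogeneous e p -> homogeneous f q -> homogeneous (e + f) (p * q).
Proof.
move=> /allP hp /allP hq; apply/allP => m /msuppM_le /allpairsP [[a b] /= []].
move=> /hp /eqP <- /hq /eqP <- ->; apply/eqP/ffunP => r.
by rewrite !ffunE mnmDE PoszD.
Qed.

Lemma homogeneous0 e : homogeneous e 0.
Proof. by rewrite /homogeneous msupp0. Qed.

Lemma homogeneousD e p q :
  homogeneous e p -> homogeneous e q -> homogeneous e (p + q).
Proof.
move=> /allP hp /allP hq; apply/allP => m /msuppD_le; rewrite mem_cat.
by case/orP; [exact: hp | exact: hq].
Qed.

Lemma homogeneousZ e c p : homogeneous e p -> homogeneous e (c *: p).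
Proof. by move=> /allP hp; apply/allP => m /msuppZ_le; exact: hp. Qed.

Lemma xpow_poly e : (forall r, 0 <= e r) ->
  exists2 p : hring, homogeneous e p & xpow e = ratfun_poly p.
Proof.
move=> e0; pose a := [multinom `|e (enum_val i)|%N | i < #|ray D|].
exists 'X_[a].
  rewrite /homogeneous msuppX /= andbT; apply/eqP/ffunP => r.
  by rewrite ffunE mnmE enum_rankK gez0_abs.
rewrite mpolyXE_id rmorph_prod (reindex (@enum_rank (ray D))) /=; last first.
  exact/onW_bij/enum_rank_bij.
apply: eq_bigr => r _; rewrite rmorphXn /= mnmE enum_rankK.
by rewrite -{1}(gez0_abs (e0 r)) -exprnP.
Qed.

Lemma homog_locP s e q : homog_loc s e q <->
  exists (N : nat) (p : hring), homogeneous (e + hat_degree s *+ N) p /\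
    q * xpow (hat_degree s *+ N) = ratfun_poly p.
Proof.
split=> -[N [p [hp eq]]]; exists N, p; split=> //.
  by rewrite eq xpow_hat xpowMn mulfVK // expf_neq0 ?xpow_neq0.
by rewrite -eq xpow_hat xpowMn mulfK // expf_neq0 ?xpow_neq0.
Qed.

Lemma hat_degree_ge0 s N r : 0 <= (hat_degree s *+ N) r.
Proof. by rewrite ffunMnE ffunE mulrn_wge0. Qed.

Lemma homog_loc_ge s e q : homog_loc s e q ->
  exists N0 : nat, forall N, (N0 <= N)%N ->
    exists p : hring, homogeneous (e + hat_degree s *+ N) p /\
      q * xpow (hat_degree s *+ N) = ratfun_poly p.
Proof.
case/homog_locP=> N0 [p [hp eq]]; exists N0 => N1 leN.
have [p' hp' ep'] := @xpow_poly (hat_degree s *+ (N1 - N0))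
  (@hat_degree_ge0 s (N1 - N0)).
exists (p * p'); rewrite -(subnKC leN) mulrnDr; split.
  by rewrite addrA; exact: homogeneousM.
by rewrite xpowD mulrA eq ep' rmorphM.
Qed.

Lemma homog_locM s e f p q :
  homog_loc s e p -> homog_loc s f q -> homog_loc s (e + f) (p * q).
Proof.
move=> /homog_locP [N [p' [hp ep]]] /homog_locP [N' [q' [hq eq]]].
apply/homog_locP; exists (N + N')%N, (p' * q'); rewrite mulrnDr; split.
  by rewrite addrACA; exact: homogeneousM.
by rewrite xpowD mulrACA ep eq rmorphM.
Qed.

Lemma homog_loc0 s e : homog_loc s e 0.
Proof.
by apply/homog_locP; exists 0%N, 0; rewrite homogeneous0 mul0r rmorph0.
Qed.

Lemma homog_locD s e p q :
  homog_loc s e p -> homog_loc s e q -> homog_loc s e (p + q).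
Proof.
move=> /homog_loc_ge [N hp] /homog_loc_ge [N' hq]; apply/homog_locP.
have [p' [hp' ep]] := hp _ (leq_addr N' N).
have [q' [hq' eq]] := hq _ (leq_addl N N').
exists (N + N')%N, (p' + q'); split; first exact: homogeneousD.
by rewrite mulrDl ep eq rmorphD.
Qed.

Lemma homog_locZ s e c q : homog_loc s e q -> homog_loc s e (c *: q).
Proof.
move=> /homog_locP [N [p [hp ep]]]; apply/homog_locP.
exists N, (c *: p); split; first exact: homogeneousZ.
by rewrite ratfun_scaleE -mulrA ep -rmorphM mul_mpolyC.
Qed.

Lemma homog_loc_poly s e p : homogeneous e p -> homog_loc s e (ratfun_poly p).
Proof.
move=> hp; apply/homog_locP; exists 0%N, p.
by rewrite mulr0n addr0 xpow0 mulr1.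
Qed.

Lemma homog_loc_xpow s e : (forall r, r \in s -> 0 <= e r) ->
  homog_loc s e (xpow e).
Proof.
move=> e0; pose N := (\sum_r `|e r|)%N.
have [|p hp ep] := @xpow_poly (e + hat_degree s *+ N).
  move=> r; rewrite ffunE ffunMnE ffunE.
  case: (boolP (r \in s)) => [/e0|_] /=; first by rewrite mul0rn addr0.
  have : (`|e r| <= N)%N by rewrite /N (bigD1 r) //= leq_addr.
  by clearbody N; rewrite -/(N%:R) natz; lia.
by apply/homog_locP; exists N, p; rewrite -xpowD.
Qed.

Lemma homog_locS s t e q : t \subset s -> homog_loc s e q -> homog_loc t e q.
Proof.
move=> /subsetP ts /homog_locP [N [p [hp ep]]].
have -> : q = ratfun_poly p * xpow (- (hat_degree s *+ N)).
  by rewrite -ep -mulrA -xpowD subrr xpow0 mulr1.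
rewrite -(addrK (hat_degree s *+ N) e); apply: homog_locM; first exact: homog_loc_poly.
apply: homog_loc_xpow => r /ts rs.
by rewrite ffunE ffunMnE ffunE rs mul0rn oppr0.
Qed.

(* F being the direct sum of the S(n i), i in I, free_sheaf is the sheaf
   associated with F: the part of degree m of its sections on U_sigma consists
   of the families whose i-th member lies in the part of degree n i + j(m) of
   the localization of S, with j = pair_degree. *)
Section FreeSheaf.
Variables (I : finType) (n : I -> degree).

Definition free_pred s (m : 'rV[int]_d) : {pred {ffun I -> ratfun k #|ray D|}} :=
  fun f => `[< forall i, homog_loc s (n i + pair_degree m) (f i) >].

Fact free_pred_closed s m : submod_closed (free_pred s m).
Proof.
split=> [|a f g /asboolP hf /asboolP hg]; apply/asboolP => i.
  by rewrite ffunE; exact: homog_loc0.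
by rewrite !ffunE; apply: homog_locD => //; exact: homog_locZ.
Qed.

HB.instance Definition _ s m := GRing.isSubmodClosed.Build k
  {ffun I -> ratfun k #|ray D|} (free_pred s m) (free_pred_closed s m).

Record free_sect s m := FreeSect {
  sect_val : {ffun I -> ratfun k #|ray D|};
  sect_valP : sect_val \in free_pred s m
}.

HB.instance Definition _ s m := [isSub for @sect_val s m].
HB.instance Definition _ s m := [Choice of free_sect s m by <:].
HB.instance Definition _ s m := [SubChoice_isSubZmodule of free_sect s m by <:].
HB.instance Definition _ s m :=
  [SubZmodule_isSubLmodule of free_sect s m by <:].

Lemma sect_loc s m (f : free_sect s m) i :
  homog_loc s (n i + pair_degree m) (sect_val f i).
Proof. by have /asboolP := sect_valP f; apply. Qed.

Lemma sect_valL s m a (f g : free_sect s m) i :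
  sect_val (a *: f + g) i = a *: sect_val f i + sect_val g i.
Proof.
have -> : sect_val (a *: f + g) = a *: sect_val f + sect_val g.
  exact: (linearP (\val : free_sect s m -> _)).
by rewrite !ffunE.
Qed.

Lemma sect_val0 s m i : sect_val (0 : free_sect s m) i = 0.
Proof.
have -> : sect_val (0 : free_sect s m) = 0.
  exact: (linear0 (\val : free_sect s m -> _)).
by rewrite ffunE.
Qed.

Lemma sect_eq s m (f g : free_sect s m) :
  (forall i, sect_val f i = sect_val g i) -> f = g.
Proof. by move=> fg; apply/val_inj/ffunP. Qed.

Lemma pair_degreeB m m' : pair_degree (m' - m) + pair_degree m = pair_degree m'.
Proof. by apply/ffunP => r; rewrite !ffunE -pairingDl subrK. Qed.

(* chi(m' - m) acts as the Laurent monomial of exponent j(m' - m). *)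
Section Multiplication.
Variables (s : {set ray D}) (m m' : 'rV[int]_d) (h : in_dual s (m' - m)).

Fact free_mul_subproof (f : free_sect s m) :
  [ffun i => xpow (pair_degree (m' - m)) * sect_val f i] \in free_pred s m'.
Proof.
apply/asboolP => i; rewrite ffunE -(pair_degreeB m m') addrCA.
apply: homog_locM (sect_loc f i); apply: homog_loc_xpow => r rs.
by rewrite ffunE; exact: (forall_inP h).
Qed.

Definition free_mul_fun f := FreeSect (free_mul_subproof f).

Lemma free_mulE f i : sect_val (free_mul_fun f) i =
  xpow (pair_degree (m' - m)) * sect_val f i.
Proof. by rewrite ffunE. Qed.

Fact free_mul_linear : linear free_mul_fun.
Proof.
move=> a f g; apply: sect_eq => i; rewrite sect_valL !free_mulE sect_valL.
by rewrite mulrDr !ratfun_scaleE mulrCA.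
Qed.

HB.instance Definition _ :=
  GRing.isLinear.Build k _ _ _ free_mul_fun free_mul_linear.

Definition free_mul : {linear free_sect s m -> free_sect s m'} := free_mul_fun.

End Multiplication.

Lemma free_mul_id s m (h : in_dual s (m - m)) (f : free_sect s m) :
  free_mul h f = f.
Proof.
apply: sect_eq => i; rewrite free_mulE subrr.
have -> : pair_degree 0 = 0 by apply/ffunP => r; rewrite !ffunE pairing0l.
by rewrite xpow0 mul1r.
Qed.

Lemma free_mul_comp s m m' m'' (h : in_dual s (m' - m))
  (h' : in_dual s (m'' - m')) (h'' : in_dual s (m'' - m)) (f : free_sect s m) :
  free_mul h' (free_mul h f) = free_mul h'' f.
Proof.
apply: sect_eq => i; rewrite !free_mulE mulrA -xpowD; congr (xpow _ * _).
by apply/ffunP => r; rewrite !ffunE -pairingDl addrA subrK.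
Qed.

Definition free_gmodule s : gmodule k s :=
  GModule (@free_mul_id s) (@free_mul_comp s).

Section Restriction.
Variables (s t : {set ray D}) (h : t \subset s) (m : 'rV[int]_d).

Fact free_res_subproof (f : free_sect s m) : sect_val f \in free_pred t m.
Proof. by apply/asboolP => i; apply: homog_locS h (sect_loc f i). Qed.

Definition free_res_fun f := FreeSect (free_res_subproof f).

Lemma free_resE f i : sect_val (free_res_fun f) i = sect_val f i.
Proof. by []. Qed.

Fact free_res_linear : linear free_res_fun.
Proof.
move=> a f g; apply: sect_eq => i.
by rewrite [LHS]free_resE [LHS]sect_valL [RHS]sect_valL.
Qed.

HB.instance Definition _ :=
  GRing.isLinear.Build k _ _ _ free_res_fun free_res_linear.

Definition free_res : {linear free_sect s m -> free_sect t m} := free_res_fun.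

End Restriction.

Lemma free_res_ker (s t : cone D) (h : val t \subset val s) m
    (x : free_sect (val s) m) :
  free_res h m x = 0 ->
  exists m' (g : in_dual (val s) (m' - m)),
    (forall r, r \in val t -> pairing (m' - m) (gen r) = 0) /\
    free_mul g x = 0.
Proof.
move=> x0; have g : in_dual (val s) (m - m).
  by apply/forall_inP => r _; rewrite subrr pairing0l.
exists m, g; split=> [r _|]; first by rewrite subrr pairing0l.
rewrite free_mul_id; apply: sect_eq => i.
by have /(congr1 (fun f => sect_val f i)) := x0; rewrite !sect_val0.
Qed.

Lemma free_res_loc (s t : cone D) (h : val t \subset val s) m
    (y : free_sect (val t) m) :
  exists m' (g : in_dual (val s) (m' - m)) (g' : in_dual (val t) (m' - m)),
    (forall r, r \in val t -> pairing (m' - m) (gen r) = 0) /\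
    exists x : free_sect (val s) m', free_res h m' x = free_mul g' y.
Proof.
have [u [us ut ust]] := face_separation (valP s) (valP t) h.
have [N Nloc] : exists N : nat, forall i, exists p : hring,
    homogeneous (n i + pair_degree m + hat_degree (val t) *+ N) p /\
    sect_val y i * xpow (hat_degree (val t) *+ N) = ratfun_poly p.
  have /choice[N hN] i := homog_loc_ge (sect_loc y i).
  by exists (\max_i N i) => i; apply: hN; exact: leq_bigmax.
pose m' := m + N%:Z *: u.
have dm r : pairing (m' - m) (gen r) = N%:Z * pairing u (gen r).
  by rewrite /m' addrC addKr pairingZl.
have g : in_dual (val s) (m' - m).
  by apply/forall_inP => r rs; rewrite dm mulr_ge0 // (forall_inP us).
have g' := in_dualS h g.
exists m', g, g'; split=> [r rt|]; first by rewrite dm ut // mulr0.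
suff xP : sect_val (free_mul g' y) \in free_pred (val s) m'.
  by exists (FreeSect xP); apply: sect_eq.
apply/asboolP => i; rewrite free_mulE; have [p [hp ep]] := Nloc i.
pose e := pair_degree (m' - m) - hat_degree (val t) *+ N.
have -> : xpow (pair_degree (m' - m)) * sect_val y i = ratfun_poly p * xpow e.
  rewrite -ep mulrC -mulrA -xpowD; congr (_ * xpow _).
  by rewrite /e addrCA subrr addr0.
have -> : n i + pair_degree m' =
    n i + pair_degree m + hat_degree (val t) *+ N + e.
  rewrite -(pair_degreeB m m') /e -!addrA; congr (_ + _).
  by rewrite [_ *+ _ + _]addrC subrK; exact: addrC.
apply: homog_locM; first exact: homog_loc_poly.
apply: homog_loc_xpow => r rs.
rewrite !ffunE ffunMnE ffunE dm; case: (boolP (r \in val t)) => [rt|rt] /=.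
  by rewrite mul0rn subr0 mulr_ge0 // (forall_inP us).
rewrite -/(N%:R) natz subr_ge0 -[X in X <= _]mulr1 ler_wpM2l //.
by rewrite -gtz0_ge1 ust.
Qed.

Definition free_sheaf : eqsheaf D k.
Proof.
refine (@EqSheaf R d D k (fun s : cone D => free_gmodule (val s))
  (fun (s t : cone D) h m => free_res h m) _ _ _ free_res_ker free_res_loc).
- by move=> s h m x; apply: sect_eq.
- by move=> s t u h h' h'' m x; apply: sect_eq.
- move=> s t h m m' g g' x; apply: sect_eq => i.
  by rewrite [LHS]free_mulE [RHS]free_mulE.
Defined.

End FreeSheaf.

(* A homogeneous matrix defines a homogeneous map from the direct sum of the
   S(n j) to that of the S(n' i), hence a map of sheaves. *)
Section MatrixMap.
Variables (I J : finType) (n : J -> degree) (n' : I -> degree).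
Variable A : I -> J -> hring.

Definition homogeneous_matrix : Prop :=
  forall i j, homogeneous (n' i - n j) (A i j).

Hypothesis homA : homogeneous_matrix.

Section Sections.
Variables (s : {set ray D}) (m : 'rV[int]_d).

Fact matrix_subproof (f : free_sect n s m) :
  [ffun i => \sum_j ratfun_poly (A i j) * sect_val f j] \in free_pred n' s m.
Proof.
apply/asboolP => i; rewrite ffunE.
elim/big_ind: _ => [|p q|j _]; [exact: homog_loc0 | exact: homog_locD |].
have -> : n' i + pair_degree m = n' i - n j + (n j + pair_degree m).
  by rewrite addrA subrK.
by apply: homog_locM (sect_loc f j); exact: homog_loc_poly.
Qed.

Definition matrix_fun f := FreeSect (matrix_subproof f).

Lemma matrixE f i : sect_val (matrix_fun f) i =
  \sum_j ratfun_poly (A i j) * sect_val f j.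
Proof. by rewrite ffunE. Qed.

Fact matrix_linear : linear matrix_fun.
Proof.
move=> a f g; apply: sect_eq => i; rewrite sect_valL !matrixE scaler_sumr.
rewrite -big_split; apply: eq_bigr => j _; rewrite sect_valL mulrDr.
by rewrite !ratfun_scaleE mulrCA.
Qed.

HB.instance Definition _ :=
  GRing.isLinear.Build k _ _ _ matrix_fun matrix_linear.

Definition matrix_sect : {linear free_sect n s m -> free_sect n' s m} :=
  matrix_fun.

End Sections.

Definition matrix_map : eqmap (free_sheaf n) (free_sheaf n').
Proof.
unshelve refine (@EqMap R d D k (free_sheaf n) (free_sheaf n')
  (fun s : cone D => @GHom R d D k (val s) (free_gmodule n (val s))
    (free_gmodule n' (val s)) (fun m => matrix_sect (val s) m) _) _).
- move=> m m' h x; apply: sect_eq => i.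
  rewrite [LHS]matrixE [RHS]free_mulE matrixE mulr_sumr; apply: eq_bigr => j _.
  by rewrite [X in _ * X]free_mulE mulrCA.
- by move=> s t h m x; apply: sect_eq => i; rewrite [LHS]matrixE [RHS]matrixE.
Defined.

End MatrixMap.

(* The degree of the prime divisor D_rho: O(D) is the sheaf of S(n) for
   D = sum n_rho D_rho. *)
Definition prime_divisor (r : ray D) : degree := [ffun r' => (r' == r)%:Z].

End HomogeneousCoordinates.

(* Main.v *)
(* Twist E so that i2 = 0 for every ray, and choose a generator e_r of each line
   E^r. Then e_r is a section of E of degree -(i2 r - i1 r) along r and of degree
   0 along the other rays, which gives a map from the sum of the O(i^r D_r),
   i^r = i2 r - i1 r, to E. In terms of the limit space E^0 it is the map
   k^Delta(1) -> E^0 sending the basis vector of r to e_r, restricted in each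
   degree to the admissible coordinates. The lines of two rays of a common cone
   being distinct, it is onto; for the same reason a nontrivial relation between
   the e_r is admissible only in the degrees of the dual cone, where every
   relation is. So the kernel is O tensored with the space of all relations, of
   dimension n - 2, and a basis K of relations gives A r j = K r j x_r^(i^r).

   What is needed about E is that its sections of degree m on U_sigma are the
   intersection, over the rays of sigma, of the corresponding terms of the
   filtrations. This follows from local freeness: two characters vanishing
   respectively on the two rays of sigma form a regular sequence. *)
From HB Require Import structures.
Require Import Defs.
From mathcomp Require Import all_boot all_order all_algebra.
From mathcomp Require Import boolp reals mpoly.
From mathcomp Require Import zify.
(* Restores [Defs.total], which ssrbool shadows. *)
Import Defs.

Set Implicit Arguments.
Unset Strict Implicit.
Unset Printing Implicit Defensive.

Import Order.TTheory GRing.Theory Num.Theory.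
Local Open Scope ring_scope.

Arguments gmul {R d D k s g m m'}.
Arguments res {R d D k e s t}.

(** * Local freeness of graded modules *)

Lemma big_pred1_seq (V : nmodType) (I : eqType) (r : seq I) i (F : I -> V) :
  uniq r -> i \in r -> \sum_(j <- r | j == i) F j = F i.
Proof.
by move=> ur ir; rewrite -big_filter filter_pred1_uniq // big_seq1.
Qed.

(** * Coefficients of polynomials given as lists of terms *)

Section Kpoly.
Variables (d : nat) (k : fieldType).
Implicit Types (f g a b c : kpoly d k) (m u v : 'rV[int]_d).

Definition kmono u : kpoly d k := [:: (1, u)].

Definition kopp a : kpoly d k := [seq (- t.1, t.2) | t <- a].

Lemma kcoef_cat a b m : kcoef (a ++ b) m = kcoef a m + kcoef b m.
Proof. by rewrite /kcoef big_cat. Qed.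

Lemma kcoef_opp a m : kcoef (kopp a) m = - kcoef a m.
Proof. by rewrite /kcoef big_map sumrN. Qed.

Lemma kcoef_mul f g m :
  kcoef (kmul f g) m = \sum_(t <- f) t.1 * kcoef g (m - t.2).
Proof.
rewrite /kcoef /kmul big_mkcond big_allpairs_dep; apply: eq_bigr => t _.
rewrite mulr_sumr -big_mkcond; apply: eq_big => w //=.
by rewrite [RHS]eq_sym subr_eq addrC eq_sym.
Qed.

Lemma kcoef_mono_mul u a m : kcoef (kmul (kmono u) a) m = kcoef a (m - u).
Proof. by rewrite kcoef_mul big_seq1 mul1r. Qed.

(** A list may repeat an exponent. Collecting equal exponents shows that whatever is additive in the
    coefficients depends on the polynomial only. *)
Lemma kcoef_sum a (V : nmodType) (F : 'rV[int]_d -> k -> V)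
    (r : seq 'rV[int]_d) :
  (forall m, F m 0 = 0) -> (forall m, {morph F m : x y / x + y}) ->
  uniq r -> {subset [seq t.2 | t <- a] <= r} ->
  \sum_(t <- a) F t.2 t.1 = \sum_(m <- r) F m (kcoef a m).
Proof.
move=> F0 FD ur sub.
under [RHS]eq_bigr do rewrite (big_morph _ (FD _) (F0 _)) big_mkcond.
rewrite exchange_big; apply: eq_big_seq => t ta /=.
rewrite -big_mkcond (eq_bigl (fun m => m == t.2)) => [|m]; last by rewrite eq_sym.
by rewrite (big_pred1_seq (fun m => F m t.1)) ?sub ?map_f.
Qed.

(** The list [c] stands for chi(u) a - chi(v) b through its coefficients alone; characters shift
    exponents, which commutes with multiplication by [f]. *)
Lemma kcoef_iter_mul f a b c u v N m :
  (forall m, kcoef c m = kcoef a (m - u) - kcoef b (m - v)) ->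
  kcoef (iter N (kmul f) c) m =
  kcoef (iter N (kmul f) a) (m - u) - kcoef (iter N (kmul f) b) (m - v).
Proof.
move=> e; elim: N m => [|N IH] m //=.
rewrite !kcoef_mul -sumrB; apply: eq_bigr => t _.
by rewrite IH mulrBr !(addrAC m (- t.2)).
Qed.

End Kpoly.

(** * The action of k[sigma_M] on a graded module *)

Section Action.
Variables (R : realType) (d : nat) (D : fan R d) (k : fieldType).
Variables (s : {set ray D}) (P : gmodule k s).
Implicit Types (f g a b : kpoly d k) (m u v : 'rV[int]_d) (p q : total P).

Lemma in_dual_refl m : in_dual s (m - m).
Proof. by apply/forall_inP => r _; rewrite subrr pairing0l. Qed.

Lemma in_dualD u v : in_dual s u -> in_dual s v -> in_dual s (u + v).
Proof.
move=> /forall_inP su /forall_inP sv; apply/forall_inP => r rs.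
by rewrite pairingDl addr_ge0 ?su ?sv.
Qed.

Lemma gmul_dfltE m m' (h : in_dual s (m' - m)) (x : P m) :
  gmul_dflt m' x = gmul h x.
Proof.
rewrite /gmul_dflt; case: {-}_ / idP => [h'|//].
by rewrite (bool_irrelevance h h').
Qed.

Lemma gmul_dfltN m m' (x : P m) : ~~ in_dual s (m' - m) -> gmul_dflt m' x = 0.
Proof. by rewrite /gmul_dflt; case: {-}_ / idP => // h /negP. Qed.

Lemma gmul_dflt_linear m m' : linear (@gmul_dflt _ _ _ _ _ P m m').
Proof.
move=> c x y; have [h|h] := boolP (in_dual s (m' - m)).
  by rewrite !(gmul_dfltE h) linearP.
by rewrite !gmul_dfltN // scaler0 addr0.
Qed.

HB.instance Definition _ m m' := GRing.isLinear.Build k (P m) (P m') _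
  (@gmul_dflt _ _ _ _ _ P m m') (@gmul_dflt_linear m m').

Lemma gmul_dflt_id m (x : P m) : gmul_dflt m x = x.
Proof. by rewrite (gmul_dfltE (in_dual_refl m)) gmul_id. Qed.

Lemma gmul_dflt_comp m m' m'' (x : P m) :
  in_dual s (m' - m) -> in_dual s (m'' - m') ->
  gmul_dflt m'' (gmul_dflt m' x) = gmul_dflt m'' x.
Proof.
move=> h h'; have h'' : in_dual s (m'' - m).
  by rewrite -(subrK m' m'') -addrA in_dualD.
by rewrite (gmul_dfltE h) (gmul_dfltE h') (gmul_dfltE h'') gmul_comp.
Qed.

Definition tadd p q : total P := fun m => p m + q m.

Definition tzero : total P := fun=> 0.

Lemma kactD f p q : kact f (tadd p q) = tadd (kact f p) (kact f q).
Proof.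
apply: functional_extensionality_dep => m.
by rewrite /tadd /kact -big_split; apply: eq_bigr => t _; rewrite linearD scalerDr.
Qed.

Lemma kact0 f : kact f tzero = tzero.
Proof.
apply: functional_extensionality_dep => m.
by apply: big1 => t _; rewrite linear0 scaler0.
Qed.

Lemma kact_cat f g p : kact (f ++ g) p = tadd (kact f p) (kact g p).
Proof. by apply: functional_extensionality_dep => m; rewrite /kact big_cat. Qed.

Lemma kact_opp f p m : kact (kopp f) p m = - kact f p m.
Proof.
by rewrite /kact big_map -sumrN; apply: eq_bigr => t _; rewrite scaleNr.
Qed.

Lemma kact_mul f g p : in_kdual s f -> in_kdual s g ->
  kact (kmul f g) p = kact f (kact g p).
Proof.
move=> /allP hf /allP hg; apply: functional_extensionality_dep => m.
rewrite /kact /kmul big_allpairs_dep; apply: eq_big_seq => t /hf ht.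
rewrite linear_sum scaler_sumr; apply: eq_big_seq => w /hg hw /=.
rewrite linearZ /= scalerA opprD addrA gmul_dflt_comp //.
  by rewrite opprB addrC subrK.
by rewrite opprB addrC subrK.
Qed.

Lemma kact_coef f g p : (forall m, kcoef f m = kcoef g m) -> kact f p = kact g p.
Proof.
move=> e; apply: functional_extensionality_dep => m.
pose r := undup ([seq t.2 | t <- f] ++ [seq t.2 | t <- g]).
have sf : {subset [seq t.2 | t <- f] <= r}.
  by move=> u uf; rewrite mem_undup mem_cat uf.
have sg : {subset [seq t.2 | t <- g] <= r}.
  by move=> u uf; rewrite mem_undup mem_cat uf orbT.
pose F u c := c *: gmul_dflt m (p (m - u)).
have F0 u : F u 0 = 0 by exact: scale0r.
have FD u : {morph F u : x y / x + y} by move=> x y; exact: scalerDl.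
rewrite /kact -!/(F _ _) (kcoef_sum F0 FD (undup_uniq _) sf).
rewrite (kcoef_sum F0 FD (undup_uniq _) sg).
by apply: eq_bigr => u _; rewrite e.
Qed.

Lemma in_kdual_mul f g : in_kdual s f -> in_kdual s g -> in_kdual s (kmul f g).
Proof.
move=> /allP hf /allP hg; apply/allP => _ /allpairsP [[t w] /= [/hf ht /hg hw ->]].
exact: in_dualD.
Qed.

Lemma in_kdual_iter f a N :
  in_kdual s f -> in_kdual s a -> in_kdual s (iter N (kmul f) a).
Proof. by move=> hf ha; elim: N => //= N; exact: in_kdual_mul. Qed.

Lemma kact_iter f a N p : in_kdual s f -> in_kdual s a ->
  kact (iter N (kmul f) a) p = iter N (kact f) (kact a p).
Proof.
by move=> hf ha; elim: N => //= N IH; rewrite kact_mul ?in_kdual_iter ?IH.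
Qed.

Lemma kactC f g p : in_kdual s f -> in_kdual s g ->
  kact f (kact g p) = kact g (kact f p).
Proof.
move=> hf hg; rewrite -!kact_mul //; apply: kact_coef => m.
rewrite kcoef_mul; under eq_bigr do rewrite mulr_sumr.
rewrite (exchange_big_dep predT) //= kcoef_mul; apply: eq_bigr => w _.
rewrite mulr_sumr; apply: eq_big => t; last by rewrite mulrC.
by rewrite eq_sym subr_eq [RHS]eq_sym subr_eq addrC.
Qed.

Lemma iter_kactC f g N p : in_kdual s f -> in_kdual s g ->
  iter N (kact f) (kact g p) = kact g (iter N (kact f) p).
Proof. by move=> hf hg; elim: N => //= N ->; rewrite kactC. Qed.

Lemma iter_kact0 f N : iter N (kact f) tzero = tzero.
Proof. by elim: N => //= N ->; rewrite kact0. Qed.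

Definition tsum n (F : 'I_n -> total P) : total P := fun m => \sum_i F i m.

Lemma kact_sum f n (F : 'I_n -> total P) :
  kact f (tsum F) = tsum (fun i => kact f (F i)).
Proof.
apply: functional_extensionality_dep => m; rewrite /tsum /kact exchange_big.
by apply: eq_bigr => t _; rewrite linear_sum scaler_sumr.
Qed.

Lemma iter_kact_sum f N n (F : 'I_n -> total P) :
  iter N (kact f) (tsum F) = tsum (fun i => iter N (kact f) (F i)).
Proof. by elim: N => //= N ->; rewrite kact_sum. Qed.

Lemma in_kdual_mono u : in_dual s u -> in_kdual s (kmono k u).
Proof. by rewrite /in_kdual /= andbT. Qed.

(** For [m' = m] the multiplication is by chi(0) = 1 and carries [x] to the type [P m']; the scalar
    kills the other degrees. *)
Definition single m (x : P m) : total P :=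
  fun m' => (m' == m)%:R *: gmul_dflt m' x.

Lemma single_id m (x : P m) : single x m = x.
Proof. by rewrite /single eqxx scale1r gmul_dflt_id. Qed.

Lemma single_neq m m' (x : P m) : m' != m -> single x m' = 0.
Proof. by move=> /negPf e; rewrite /single e scale0r. Qed.

Lemma single_supp m (x : P m) : fin_supp (single x).
Proof. by exists [:: m] => m'; rewrite inE => /single_neq. Qed.

Lemma kact_mono_single u m m' (x : P m) (g : in_dual s (m' - m)) :
  u = m' - m -> kact (kmono k u) (single x) = single (gmul g x).
Proof.
move=> ->; apply: functional_extensionality_dep => w.
rewrite /kact big_seq1 scale1r /=.
have [->|wm'] := eqVneq w m'; last first.
  rewrite !single_neq ?linear0 //; apply: contra wm'.
  by rewrite subr_eq [m + _]addrC subrK.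
rewrite single_id /single subKr eqxx scale1r gmul_dflt_comp ?in_dual_refl //.
by rewrite (gmul_dfltE g).
Qed.

Definition submodule (Q : total P -> Prop) : Prop :=
  [/\ Q tzero, forall p q, Q p -> Q q -> Q (tadd p q)
    & forall f p, in_kdual s f -> Q p -> Q (kact f p)].

(* If all the N gf are positive, then by induction Q contains each gf.2 p,
   hence p = sum gf.1 gf.2 p. *)
Lemma submodule_local (l : seq (kpoly d k * kpoly d k)) (Q : total P -> Prop) p :
  (forall gf, gf \in l -> in_kdual s gf.1 /\ in_kdual s gf.2) ->
  (forall m, kcoef (flatten [seq kmul gf.1 gf.2 | gf <- l]) m = (m == 0)%:R) ->
  submodule Q ->
  (forall gf, gf \in l -> exists N, Q (iter N (kact gf.2) p)) -> Q p.
Proof.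
move=> hl l1 [Q0 QD QM] /(_ _ _)/cid hN.
have {hN} [N hN] : exists N : kpoly d k * kpoly d k -> nat,
    forall gf, gf \in l -> Q (iter (N gf) (kact gf.2) p).
  exists (fun gf =>
    if @idP (gf \in l) is ReflectT h then projT1 (hN gf h) else 0%N).
  by move=> gf gfl; case: {-}_ / idP => // h; case: (hN gf h).
have [n] := ubnP (\sum_(gf <- l) N gf)%N.
elim: n => // n IH in p N hN *; rewrite ltnS => sN.
have [[gf gfl N0]|Npos] := EM (exists2 gf, gf \in l & N gf = 0%N).
  by have := hN _ gfl; rewrite N0.
have Qf gf : gf \in l -> Q (kact gf.2 p).
  move=> gfl; have Ngf : (0 < N gf)%N by rewrite lt0n; apply/eqP => e;
    apply: Npos; exists gf.
  (* Passing from [p] to [gf.2 p] lowers the exponent of [gf] by one and keeps the others valid, the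
     actions being commutative. *)
  apply: (IH _ (fun x => N x - (x == gf))%N) => [x xl|].
    have [->|_] := eqVneq x gf.
      by rewrite -iterSr subn1 prednK //; apply: hN.
    rewrite subn0 iter_kactC ?(hl _ xl).2 ?(hl _ gfl).2 //.
    by apply: QM (hN _ xl); case: (hl _ gfl).
  apply: leq_trans sN; rewrite (big_rem gf) //= [X in (_ < X)%N](big_rem gf) //=.
  rewrite eqxx subn1 -addSn prednK // leq_add2l leq_sum // => x _.
  exact: leq_subr.
suff Ql l' : {subset l' <= l} ->
    Q (kact (flatten [seq kmul gf.1 gf.2 | gf <- l']) p).
  rewrite (_ : p = kact (kmono k 0) p).
    rewrite -(@kact_coef (flatten [seq kmul gf.1 gf.2 | gf <- l])); first exact: Ql.
    by move=> m; rewrite l1 /kcoef /kmono big_mkcond big_seq1 /= eq_sym;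
      case: (_ == _).
  apply: functional_extensionality_dep => m.
  by rewrite /kact big_seq1 subr0 scale1r gmul_dflt_id.
elim: l' => [|gf l' IHl] sl /=.
  rewrite (_ : kact _ _ = tzero) //.
  by apply: functional_extensionality_dep => m; rewrite /kact big_nil.
have gfl : gf \in l by apply: sl; exact: mem_head.
rewrite kact_cat; apply: QD; last by apply: IHl => x xl; apply: sl;
  rewrite inE xl orbT.
by have [h h'] := hl _ gfl; rewrite kact_mul //; apply: QM => //; exact: Qf.
Qed.

(** * Torsion and regular pairs of characters on a free localization *)

Section FreeOn.
Variables (n : nat) (f : kpoly d k).
Hypotheses (fs : in_kdual s f) (Pf : free_on n P f).

(** Up to a power of [f], [p] is a combination of the basis, and freeness makes a power of [f] kill
    chi(u) times each coordinate. As chi(u) only shifts exponents, the same power kills the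
    coordinate. *)
Lemma free_on_torsion u p : in_dual s u -> fin_supp p ->
  kact (kmono k u) p = tzero -> exists N, iter N (kact f) p = tzero.
Proof.
move=> us fp p0; have [e [_ gen_e free_e]] := Pf.
have [N [a [ha ea]]] := gen_e _ fp.
have us' := in_kdual_mono us.
have [|m|N' hN'] := free_e (fun i => kmul (kmono k u) (a i)).
- by move=> i; exact: in_kdual_mul.
- transitivity (kact (kmono k u) (iter N (kact f) p) m).
    transitivity (kact (kmono k u) (tsum (fun i => kact (a i) (e i))) m).
      by rewrite kact_sum; apply: eq_bigr => i _; rewrite kact_mul.
    by congr (kact _ _ m); apply: functional_extensionality_dep => w; rewrite ea.
  by rewrite -iter_kactC // p0 iter_kact0.
exists (N' + N)%N; rewrite iterD.
have -> : iter N (kact f) p = tsum (fun i => kact (a i) (e i)).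
  by apply: functional_extensionality_dep => w; rewrite ea.
rewrite iter_kact_sum; apply: functional_extensionality_dep => m;
  apply: big1 => i _.
rewrite -kact_iter // (@kact_coef _ [::]); first by rewrite /kact big_nil.
move=> w; rewrite [RHS]/kcoef big_nil; have := hN' i (w + u).
rewrite (@kcoef_iter_mul _ _ _ (a i) [::] _ u 0).
  rewrite addrK => /eqP; rewrite subr_eq0 => /eqP ->.
  elim: N' {hN'} (w + u - 0) => [|N' IH] w'; first by rewrite /kcoef big_nil.
  by rewrite /= kcoef_mul big1 // => t _; rewrite IH mulr0.
by move=> w'; rewrite kcoef_mono_mul {3}/kcoef big_nil subr0.
Qed.

(** The hypothesis on exponents is regularity of the pair chi(u), chi(v) for monomials: chi(u)
    divides chi(m) whenever it divides chi(m + v). Comparing coordinates in the basis carries this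
    over to [P]. *)
Lemma free_on_regular u v p q :
  in_dual s u -> in_dual s v ->
  (forall m, in_dual s m -> in_dual s (m + v - u) -> in_dual s (m - u)) ->
  fin_supp p -> fin_supp q ->
  kact (kmono k v) p = kact (kmono k u) q ->
  exists N w, iter N (kact f) p = kact (kmono k u) w.
Proof.
move=> us vs reg fp fq pq; have [e [_ gen_e free_e]] := Pf.
have [Np [a [ha ea]]] := gen_e _ fp.
have [Nq [b [hb eb]]] := gen_e _ fq.
have us' := in_kdual_mono us; have vs' := in_kdual_mono vs.
have eqt (x : total P) (y : 'I_n -> total P) :
  (forall m, x m = \sum_i y i m) -> x = tsum y.
  by move=> exy; apply: functional_extensionality_dep => w; rewrite exy.
move/eqt in ea; move/eqt in eb.
(* The powers are crossed so that [p] and [q] are both multiplied by f^(Nq + Np). *)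
pose c i := iter Nq (kmul f) (a i); pose g i := iter Np (kmul f) (b i).
have hc i : in_kdual s (c i) by exact: in_kdual_iter.
have hg i : in_kdual s (g i) by exact: in_kdual_iter.
have ec : iter (Nq + Np) (kact f) p = tsum (fun i => kact (c i) (e i)).
  rewrite iterD ea iter_kact_sum; congr tsum.
  by apply: functional_extensionality_dep => i; rewrite kact_iter.
have eg : iter (Nq + Np) (kact f) q = tsum (fun i => kact (g i) (e i)).
  rewrite addnC iterD eb iter_kact_sum; congr tsum.
  by apply: functional_extensionality_dep => i; rewrite kact_iter.
have kopp_s (x : kpoly d k) : in_kdual s x -> in_kdual s (kopp x).
  by move=> hx; rewrite /in_kdual all_map.
have [||N hN] :=
    free_e (fun i => kmul (kmono k v) (c i) ++ kopp (kmul (kmono k u) (g i))).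
- move=> i; rewrite /in_kdual all_cat; apply/andP; split.
    exact: in_kdual_mul.
  by apply: kopp_s; exact: in_kdual_mul.
- move=> m; transitivity (kact (kmono k v) (iter (Nq + Np) (kact f) p) m -
                          kact (kmono k u) (iter (Nq + Np) (kact f) q) m).
    rewrite ec eg !kact_sum -sumrB; apply: eq_bigr => i _.
    by rewrite kact_cat /tadd kact_opp !kact_mul.
  by rewrite -!iter_kactC // pq subrr.
have {}hN i m : kcoef (iter N (kmul f) (c i)) (m - v) =
                kcoef (iter N (kmul f) (g i)) (m - u).
  apply/eqP; rewrite -subr_eq0; apply/eqP; rewrite -[RHS](hN i m).
  apply/esym/kcoef_iter_mul => w.
  by rewrite kcoef_cat kcoef_opp !kcoef_mono_mul.
have coef_out (x : kpoly d k) m : in_kdual s x -> ~~ in_dual s m -> kcoef x m = 0.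
  move=> /allP hx hm; rewrite /kcoef big1_seq // => t /andP[/eqP tm /hx].
  by rewrite tm (negPf hm).
(* The quotient of f^N c_i by chi(u), each exponent being listed once. The exponents removed by the
   filter have coefficient 0. *)
pose h i : kpoly d k := [seq (kcoef (iter N (kmul f) (c i)) m, m - u) |
  m <- undup [seq t.2 | t <- iter N (kmul f) (c i)] & in_dual s (m - u)].
exists (N + (Nq + Np))%N, (tsum (fun i => kact (h i) (e i))).
rewrite kact_sum iterD ec iter_kact_sum; congr tsum.
apply: functional_extensionality_dep => i.
have hh : in_kdual s (h i).
  by apply/allP => _ /mapP [m + ->] /=; rewrite mem_filter => /andP[].
rewrite -kact_iter // -kact_mul //; apply: kact_coef => m.
rewrite kcoef_mono_mul [RHS]/kcoef big_map big_filter_cond.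
set x := iter N (kmul f) (c i).
have xs : in_kdual s x by exact: in_kdual_iter.
rewrite (eq_bigl (fun m' => in_dual s (m - u) && (m' == m))); last first.
  by move=> m'; rewrite (inj_eq (addIr _)); case: eqVneq => [->|]; rewrite ?andbF.
(* A nonzero coefficient at [m] would reappear in f^N g_i at m + v - u, putting this exponent in the
   dual cone, and [reg] would apply. *)
have [mu|mu] := boolP (in_dual s (m - u)); last first.
  rewrite big_pred0 //; apply/eqP/negPn/negP => x0.
  have ms : in_dual s m by apply: contraNT x0 => /(coef_out _ _ xs) ->.
  suff mvu : in_dual s (m + v - u) by rewrite reg in mu.
  apply: contraNT x0 => mvu; rewrite -(addrK v m) hN.
  by rewrite coef_out // in_kdual_iter.
have [mx|mx] := boolP (m \in [seq t.2 | t <- x]).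
  by rewrite big_pred1_seq ?undup_uniq ?mem_undup.
rewrite [RHS]big1_seq; last first.
  by move=> m' /= /andP[/eqP ->]; rewrite mem_undup (negPf mx).
rewrite /kcoef big1_seq // => t /andP[/eqP tm tx].
by rewrite -tm map_f in mx.
Qed.

End FreeOn.

(** * Descent from a covering to the whole chart *)

Section LocallyFree.
Variable n : nat.
Hypothesis Pn : locally_free n P.

(** The zero submodule satisfies [submodule_local], so vanishing can be tested on the open sets of
    the covering. *)
Lemma locally_free_torsion m m' (g : in_dual s (m' - m)) (x : P m) :
  gmul g x = 0 -> x = 0.
Proof.
move=> x0; have [l [ls l1 lf]] := Pn.
suff : single x = tzero by move/(congr1 (fun p => p m)); rewrite single_id.
apply: (submodule_local (Q := fun p => p = tzero) ls l1).
  split=> [//|p q -> ->|f p _ ->]; last exact: kact0.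
  by apply: functional_extensionality_dep => w; exact: addr0.
move=> gf gfl; apply: (free_on_torsion _ (lf _ gfl) g (single_supp x)).
  by case: (ls _ gfl).
rewrite (kact_mono_single x g) // x0.
by apply: functional_extensionality_dep => w; rewrite /single linear0 scaler0.
Qed.

(** The multiples of chi(u) form a submodule, so divisibility of [x] can be tested on the open sets
    of the covering. *)
Lemma locally_free_regular u v m (x : P (m + u)) (y : P (m + v)) :
  in_dual s u -> in_dual s v ->
  (forall m, in_dual s m -> in_dual s (m + v - u) -> in_dual s (m - u)) ->
  gmul_dflt (m + u + v) x = gmul_dflt (m + u + v) y ->
  exists z : P m, gmul_dflt (m + u) z = x.
Proof.
move=> us vs reg xy; have [l [ls l1 lf]] := Pn.
have gx : in_dual s (m + u + v - (m + u)) by rewrite (addrAC (m + u)) subrr add0r.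
have gy : in_dual s (m + u + v - (m + v)) by rewrite (addrAC m) (addrAC (m + v)) subrr add0r.
have us' := in_kdual_mono us.
suff [w] : exists w, single x = kact (kmono k u) w.
  move/(congr1 (fun p => p (m + u)));
    rewrite single_id /kact big_seq1 scale1r /= => ->.
  have h : in_dual s (m - (m + u - u)) by rewrite addrK in_dual_refl.
  have h' : in_dual s (m + u - m) by rewrite (addrC m) addrK.
  by exists (gmul_dflt m (w (m + u - u))); rewrite gmul_dflt_comp.
apply: (submodule_local (Q := fun p => exists w, p = kact (kmono k u) w) ls l1).
  split=> [|p q [p' ->] [q' ->]|f p fs [w ->]].
  - by exists tzero; rewrite kact0.
  - by exists (tadd p' q'); rewrite kactD.
  - by exists (kact f w); rewrite kactC.
move=> gf gfl.
apply: (free_on_regular _ (lf _ gfl) us vs reg (single_supp x) (single_supp y)).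
  by case: (ls _ gfl).
rewrite (kact_mono_single x gx) ?(kact_mono_single y gy).
- by rewrite -(gmul_dfltE gx) -(gmul_dfltE gy) xy.
- by rewrite (addrAC m) (addrAC (m + v)) subrr add0r.
- by rewrite (addrAC (m + u)) subrr add0r.
Qed.

End LocallyFree.

End Action.

(** * The fibre at the unit of the torus *)

Section Augmentation.
Variables (R : realType) (d : nat) (D : fan R d) (k : fieldType).
Variable P : gmodule k (set0 : {set ray D}).
Implicit Types (f g : kpoly d k) (p : total P).

(* The value at the unit of the torus. *)
Definition aug f : k := \sum_(t <- f) t.1.

Lemma aug_mul f g : aug (kmul f g) = aug f * aug g.
Proof.
rewrite /aug /kmul big_allpairs_dep mulr_suml; apply: eq_bigr => t _.
by rewrite mulr_sumr.
Qed.

Lemma aug_coef f : (forall m, kcoef f m = (m == 0)%:R) -> aug f = 1.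
Proof.
move=> f1; pose r := undup (0 :: [seq t.2 | t <- f]).
have sub : {subset [seq t.2 | t <- f] <= r}.
  by move=> m mf; rewrite mem_undup inE mf orbT.
transitivity (\sum_(m <- r) kcoef f m).
  by apply: (@kcoef_sum _ _ f k (fun _ => id)); rewrite ?undup_uniq.
under eq_bigr do rewrite f1.
transitivity (\sum_(m <- r | m == 0) (1 : k)).
  by rewrite [RHS]big_mkcond; apply: eq_bigr => m _; case: (m == 0).
by rewrite (big_pred1_seq (fun=> 1)) ?undup_uniq // mem_undup mem_head.
Qed.

Definition tsupp p : seq 'rV[int]_d :=
  if pselect (fin_supp p) is left h then undup (projT1 (cid h)) else [::].

(* The image of p in the fibre at the unit of the torus, identified with P_0. *)
Definition fibre p : P 0 := \sum_(m <- tsupp p) gmul_dflt 0 (p m).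

(** Two lists containing the support differ only in degrees where [p] vanishes, so the list chosen
    in [tsupp] does not matter. *)
Lemma fibreE p r : uniq r -> (forall m, m \notin r -> p m = 0) ->
  fibre p = \sum_(m <- r) gmul_dflt 0 (p m).
Proof.
move=> ur pr; have [us sp] : uniq (tsupp p) /\ forall m, m \notin tsupp p -> p m = 0.
  rewrite /tsupp; case: pselect => [h|[]]; last by exists r.
  case: (cid h) => l hl /=; split=> [|m]; first exact: undup_uniq.
  by rewrite mem_undup => /hl.
rewrite /fibre (bigID (fun m => p m == 0)) [RHS](bigID (fun m => p m == 0)) /=.
rewrite !(big1 _ (fun m => p m == 0)) => [|m /eqP->|m /eqP->]; try exact: linear0.
rewrite !add0r -[LHS]big_filter -[RHS]big_filter; apply/perm_big/uniq_perm;
  rewrite ?filter_uniq //.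
move=> m; rewrite !mem_filter; case: eqP => //= /eqP pm.
have -> : m \in tsupp p by apply: contraNT pm => /sp ->.
by apply/esym; apply: contraNT pm => /pr ->.
Qed.

Lemma fibre_kact f p : fin_supp p -> fibre (kact f p) = aug f *: fibre p.
Proof.
move=> [l hl]; pose r := undup [seq m + t.2 | t <- f, m <- l].
have kr t : t \in f -> forall m, m - t.2 \in l -> m \in r.
  by move=> tf m ml; rewrite mem_undup; apply/allpairsP; exists (t, m - t.2);
    rewrite /= subrK.
rewrite (@fibreE _ r) ?undup_uniq // => [|m mr]; last first.
  rewrite /kact big1_seq // => t /= tf; rewrite hl ?linear0 ?scaler0 //.
  by apply: contra mr; exact: kr.
under eq_bigr do rewrite linear_sum; rewrite exchange_big scaler_suml.
apply: eq_big_seq => t tf; under eq_bigr do rewrite linearZ /=.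
rewrite -scaler_sumr; congr (_ *: _).
rewrite (@fibreE p [seq m - t.2 | m <- r]).
- rewrite big_map; apply: eq_bigr => m _.
  by rewrite gmul_dflt_comp ?in_dual0.
- by rewrite map_inj_uniq ?undup_uniq //; exact: addIr.
- move=> m mr; apply: hl; apply: contra mr => ml; apply/mapP; exists (m + t.2);
    rewrite ?addrK //.
  by rewrite (kr t) // addrK.
Qed.

Lemma fin_supp_kact f p : fin_supp p -> fin_supp (kact f p).
Proof.
move=> [l hl]; exists [seq m + t.2 | t <- f, m <- l] => m mr.
rewrite /kact big1_seq // => t /= tf; rewrite hl ?linear0 ?scaler0 //.
by apply: contra mr => ml; apply/allpairsP; exists (t, m - t.2); rewrite /= subrK.
Qed.

Lemma fibre_iter f p N : fin_supp p ->
  fibre (iter N (kact f) p) = aug f ^+ N *: fibre p.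
Proof.
move=> fp; suff : fin_supp (iter N (kact f) p) /\ 
    fibre (iter N (kact f) p) = aug f ^+ N *: fibre p by case.
elim: N => [|N [fN IH]] /=; first by rewrite scale1r.
by split; [exact: fin_supp_kact | rewrite fibre_kact // IH scalerA -exprS].
Qed.

Lemma fibre_sum n (F : 'I_n -> total P) : (forall i, fin_supp (F i)) ->
  fibre (tsum F) = \sum_i fibre (F i).
Proof.
move=> /choice [l hl]; pose r := undup (flatten [seq l i | i <- enum 'I_n]).
have hr i m : m \notin r -> F i m = 0.
  move=> mr; apply: hl; apply: contra mr => ml; rewrite mem_undup.
  by apply/flattenP; exists (l i) => //; rewrite map_f ?mem_enum.
rewrite (@fibreE _ r) ?undup_uniq //; last first.
  by move=> m mr; apply: big1 => i _; exact: hr.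
under eq_bigr do rewrite linear_sum.
rewrite exchange_big; apply: eq_bigr => i _.
by rewrite (@fibreE _ r) ?undup_uniq //; exact: hr.
Qed.

Lemma fibre_single (x : P 0) : fibre (single x) = x.
Proof.
rewrite (@fibreE _ [:: 0]) // => [|m]; last by rewrite inE => /single_neq.
by rewrite big_seq1 single_id gmul_dflt_id.
Qed.

(** As sum g f = 1, some [f] of the covering is nonzero at the unit. Every element is a combination
    of the basis up to a power of this [f], which becomes an invertible scalar in the fibre; so the
    values of the basis span. *)
Lemma locally_free_span n : locally_free n P ->
  exists b : 'I_n -> P 0, forall x, exists c : 'I_n -> k, x = \sum_i c i *: b i.
Proof.
move=> [l [ls l1 lf]].
have [gf gfl f0] : exists2 gf, gf \in l & aug gf.2 != 0.
  apply/hasP; apply: contraT => /hasPn h.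
  have /eqP := aug_coef l1; rewrite -(@oner_eq0 k) => /eqP <-.
  rewrite eq_sym {1}/aug big_flatten big_map big1_seq // => gf /= gfl.
  by rewrite -/(aug _) aug_mul; move: (h _ gfl); rewrite negbK => /eqP ->;
    rewrite mulr0.
have [e [fe gen_e _]] := lf _ gfl; exists (fun i => fibre (e i)) => x.
have [N [a [_ ea]]] := gen_e _ (single_supp x).
have {}ea : iter N (kact gf.2) (single x) = tsum (fun i => kact (a i) (e i)).
  by apply: functional_extensionality_dep => w; rewrite ea.
exists (fun i => (aug gf.2 ^+ N)^-1 * aug (a i)).
under eq_bigr do rewrite -scalerA -fibre_kact //.
rewrite -scaler_sumr -fibre_sum; last by move=> i; exact: fin_supp_kact.
rewrite -ea fibre_iter; last exact: single_supp.
by rewrite fibre_single scalerA mulVf ?scale1r // expf_neq0.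
Qed.

End Augmentation.

(** * Smooth fans *)

Section SmoothFans.
Variables (R : realType) (d : nat) (D : fan R d).
Hypothesis smD : smooth D.

Lemma smooth_rows (s : {set ray D}) : s \in cones D ->
  exists2 B : 'M[int]_d, B \in unitmx &
    exists2 f : ray D -> 'I_d, {in s &, injective f} &
      forall r, r \in s -> gen r = row (f r) B.
Proof.
move=> sD; have [B uB hB] := smD sD; exists B => //.
(* A default row index is needed. For the empty cone it comes from any ray of the fan; if there is
   none, the function has an empty domain. *)
have [->|[r0 r0s]] := set_0Vmem s; last have [i0 _] := hB _ r0s.
  have [r0 _|e] := pickP (ray D).
    have [B' _ hB'] := smD (ray_in_cones r0); have [i _] := hB' _ (set11 r0).
    by exists (fun=> i); [move=> r ?|move=> r]; rewrite inE.
  exists (fun r => False_rect _ (Bool.diff_true_false (e r)));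
    last by move=> r; have := e r.
  by move=> r; have := e r.
pose f r := if pselect (r \in s) is left h then projT1 (cid (hB r h)) else i0.
have fP r : r \in s -> gen r = row (f r) B.
  by move=> rs; rewrite /f; case: pselect => // h; case: (cid _).
exists f => // r r' rs r's e; apply: gen_inj.
by rewrite fP // [RHS]fP // e.
Qed.

Lemma smooth_functional (s : {set ray D}) (a : ray D -> int) : s \in cones D ->
  exists m, forall r, r \in s -> pairing m (gen r) = a r.
Proof.
move=> /smooth_rows [B uB [f injf hB]].
(* The coordinates of the functional in the basis dual to the rows of [B]; each sum has at most one
   term since [f] is injective on [s]. *)
pose v : 'rV[int]_d := \row_i \sum_(r in s | f r == i) a r.
exists (v *m (invmx B)^T) => r rs; rewrite hB //.
have -> m : pairing m (row (f r) B) = (m *m B^T) 0 (f r).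
  by rewrite mxE; apply: eq_bigr => i _; rewrite !mxE.
rewrite -mulmxA -trmx_mul mulmxV // trmx1 mulmx1 mxE (big_pred1 r) // => r'.
by apply/andP/eqP => [[r's /eqP /injf ->]|->].
Qed.

End SmoothFans.

Section SmoothSurfaces.
Variables (R : realType) (D : fan R 2).
Hypothesis smD : smooth D.

Lemma smooth_card (s : {set ray D}) : s \in cones D -> (#|s| <= 2)%N.
Proof.
move=> /(smooth_rows smD) [B _ [f injf _]].
by rewrite -[X in (_ <= X)%N]card_ord -(card_in_imset injf) max_card.
Qed.

(** Two distinct rays occupy two different rows of the unimodular 2 by 2 matrix, hence all its
    rows. *)
Lemma smooth_dim2 (s : {set ray D}) r r' :
  s \in cones D -> r \in s -> r' \in s -> r != r' -> s \in cones_of_dim D 2.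
Proof.
move=> sD rs r's rr'; rewrite inE sD /=.
have [B uB [f injf hB]] := smooth_rows smD sD.
rewrite eqn_leq rank_leq_col /=.
have uBR : (map_mx intr B : 'M[R]_2) \in unitmx.
  by rewrite unitmxE det_map_mx rmorph_unit.
apply: leq_trans (mxrankS (_ : map_mx intr B <= _)%MS);
  first by rewrite mxrank_unit.
 apply/row_subP => i.
have [r0 r0s fr0] : exists2 r0, r0 \in s & f r0 = i.
  have ff' : f r != f r' by apply: contra rr' => /eqP /injf ->.
  have : i = f r \/ i = f r'.
    move: (f r) (f r') ff' => i1 i2;
      case: i i1 i2 => [[|[|i]] hi] [[|[|i1]] h1] [[|[|i2]] h2] //;
    by move=> _; try (by left; apply/val_inj); try (by right; apply/val_inj).
  by case=> ->; [exists r | exists r'].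
apply: submx_trans (sumsmx_sup r0 r0s (submx_refl _)).
by rewrite genmxE -fr0 -map_row -hB.
Qed.

(** Otherwise each vector (1, N) would lie on a ray. These vectors are pairwise not proportional,
    while there are finitely many rays. *)
Lemma complete_cone2 : complete D ->
  exists s, exists r r', [/\ s \in cones D, r \in s, r' \in s & r != r'].
Proof.
move=> cD; pose x N : 'rV[R]_2 := \row_j (if j == 0 then 1 else N%:R).
apply: contrapT => no2.
have hN (N : nat) : exists (r : ray D) (c : R), x N = c *: toR R (gen r).
  have [s sD [c [_ e]]] := cD (x N).
  have [s0|[r rs]] := set_0Vmem s.
    have := congr1 (fun v : 'rV[R]_2 => v 0 0) e.
    by rewrite s0 big_set0 !mxE /= => /eqP; rewrite oner_eq0.
  exists r, (c r); rewrite e (big_pred1 r) // => r'.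
  apply/idP/eqP => [r's|->//]; apply: contrapT => /eqP rr'.
  by apply: no2; exists s, r', r.
move/choice: hN => [f hf].
have : (#|ray D|.+1 <= #|ray D|)%N; last by rewrite ltnn.
rewrite -[X in (X <= _)%N]card_ord.
apply: (leq_card (f \o @nat_of_ord _)) => N N' /= eN; apply/val_inj.
have [c hc] := hf N; have [c' hc'] := hf N'; rewrite eN in hc.
pose g := toR R (gen (f N')).
have c0 n a : x n = a *: g -> a * g 0 0 = 1 /\ a * g 0 1 = n%:R.
  by move=> /rowP h; have := h 0; have := h 1; rewrite !mxE.
have [h1 h2] := c0 _ _ hc; have [h3 h4] := c0 _ _ hc'.
apply/eqP; rewrite -(eqr_nat R) /= -h2 -h4; apply/eqP; congr (_ * _).
by rewrite -[c]mulr1 -h3 mulrCA h1 mulr1.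
Qed.

End SmoothSurfaces.

(** * Sections as subspaces of the limit space *)

Section Embedding.
Variables (R : realType) (d : nat) (D : fan R d) (k : fieldType).
Variable E : eqsheaf D k.
Implicit Types (s t : cone D) (m : 'rV[int]_d) (v : limit_space E).

(** All sections are compared in one space, where multiplication by characters and restriction leave
    the vector unchanged. *)
Definition emb s m : {linear E s m -> limit_space E} :=
  to_limit E m \o res (zero_cone_sub s) m.

Lemma emb_mul s m m' (g : in_dual (val s) (m' - m)) (x : E s m) :
  emb s m' (gmul g x) = emb s m x.
Proof.
rewrite /emb /= (res_mul _ _ (in_dualS (zero_cone_sub s) g)) /to_limit.
exact: gmul_comp.
Qed.

Lemma emb_dflt s m m' (x : E s m) : in_dual (val s) (m' - m) ->
  emb s m' (gmul_dflt m' x) = emb s m x.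
Proof. by move=> g; rewrite (gmul_dfltE g) emb_mul. Qed.

Lemma emb_res s t (h : val t \subset val s) m (x : E s m) :
  emb t m (res h m x) = emb s m x.
Proof. by rewrite /emb /= (res_comp _ _ (zero_cone_sub s)). Qed.

Lemma to_limitK m (y : E (zero_cone D) m) :
  gmul (in_dual0 D (m - 0)) (to_limit E m y) = y.
Proof.
by rewrite /to_limit (gmul_comp _ _ (in_dual_refl _ _)) gmul_id.
Qed.

Lemma emb_zero_surj m v : exists x : E (zero_cone D) m, emb (zero_cone D) m x = v.
Proof.
exists (gmul (in_dual0 D (m - 0)) v).
rewrite emb_mul /emb /= res_id /to_limit.
by rewrite (bool_irrelevance (in_dual0 D (0 - 0)) (in_dual_refl _ 0)) gmul_id.
Qed.

Lemma filtration_emb s m (x : E s m) r : r \in val s ->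
  filtration r (pairing m (gen r)) (emb s m x).
Proof.
move=> rs; have h : val (ray_cone r) \subset val s by rewrite sub1set.
by exists m, (res h m x); split=> //; rewrite -(emb_res h).
Qed.

(** Degrees with the same pairing against [gen r] differ by an element orthogonal to the ray, whose
    character is a unit on U_r; so any of them computes the filtration. *)
Lemma filtrationP r m v : filtration r (pairing m (gen r)) v <->
  exists x : E (ray_cone r) m, emb (ray_cone r) m x = v.
Proof.
split=> [[m' [x [e ->]]]|[x <-]]; last by apply: filtration_emb; exact: set11.
have g : in_dual (val (ray_cone r)) (m - m').
  by apply/forall_inP => r'; rewrite inE => /eqP ->;
    rewrite pairingDl pairingNl e subrr.
by exists (gmul g x); rewrite emb_mul.
Qed.

Section VectorBundle.
Variable n : nat.
Hypothesis En : vector_bundle n E.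

(** A section vanishing on the torus is killed by a character, and there is no torsion. *)
Lemma emb_inj s m : injective (emb s m).
Proof.
apply: raddf_inj => x; rewrite /emb /= => /(congr1 (gmul (in_dual0 D (m - 0)))).
rewrite to_limitK linear0 => /res_ker [m' [g [_]]].
exact: (locally_free_torsion (En s)).
Qed.

(** In the case of two rays, [v] extends to U_s after multiplication by a character orthogonal to
    the first ray, and also by one orthogonal to the second. These form a regular pair, so [v]
    itself extends. *)
Lemma emb_glue s m v : (#|val s| <= 2)%N ->
  (forall r, r \in val s -> filtration r (pairing m (gen r)) v) ->
  exists x : E s m, emb s m x = v.
Proof.
move=> s2 fv; have [s0|[r1 r1s]] := set_0Vmem (val s).
  by rewrite (val_inj (s0 : val s = val (zero_cone D))); exact: emb_zero_surj.
have [s1|[r2]] := set_0Vmem (val s :\ r1).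
  have -> : s = ray_cone r1.
    by apply: val_inj; rewrite /= -(setD1K r1s) s1 setU0.
  by apply/filtrationP; exact: fv.
rewrite in_setD1 => /andP[r21 r2s].
have s12 : val s = [set r1; r2].
  apply/esym/eqP; rewrite eqEcard subUset !sub1set r1s r2s /=.
  by rewrite cards2 eq_sym r21.
have lift r : r \in val s -> exists u (z : E s (m + u)),
    [/\ in_dual (val s) u, pairing u (gen r) = 0 & emb s (m + u) z = v].
  move=> rs; have /filtrationP [x xv] := fv _ rs.
  have h : val (ray_cone r) \subset val s by rewrite sub1set.
  have [m' [g [g' [ort [z ez]]]]] := res_loc h x.
  have e : m + (m' - m) = m' by rewrite addrC subrK.
  have ge : in_dual (val s) (m + (m' - m) - m') by rewrite e in_dual_refl.
  exists (m' - m), (gmul ge z); split=> //; first by apply: ort; exact: set11.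
  by rewrite emb_mul -(emb_res h) ez emb_mul.
have [u [x [us u1 xv]]] := lift _ r1s; have [w [y [ws w2 yv]]] := lift _ r2s.
have [||z zx] := locally_free_regular (En s) (m := m) (x := x) (y := y) us ws.
(* Subtracting [u] changes nothing at [r1], and adding [w] changes nothing at [r2]. *)
- move=> a /forall_inP sa /forall_inP sb; apply/forall_inP => r.
  rewrite s12 !inE => /orP[] /eqP ->.
    by rewrite pairingDl pairingNl u1 subr0 sa.
  by have := sb _ r2s; rewrite !pairingDl w2 addr0.
- apply: (@emb_inj s); rewrite !emb_dflt ?xv ?yv //.
    by rewrite (addrAC m) (addrAC (m + w)) subrr add0r.
  by rewrite (addrAC (m + u)) subrr add0r.
by exists z; rewrite -xv -zx emb_dflt // (addrC m) addrK.
Qed.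

End VectorBundle.

End Embedding.

(** * Coefficients of sections of free sheaves *)

Section Coefficients.
Variables (R : realType) (d : nat) (D : fan R d) (k : fieldType).
Local Notation degree := {ffun ray D -> int}.
Implicit Types (s t : {set ray D}) (e : degree) (m : 'rV[int]_d).

Lemma mon_degree_inj : injective (@mon_degree R d D).
Proof.
move=> a b /ffunP ab; apply/mnmP => i.
by have := ab (enum_val i); rewrite !ffunE enum_valK => -[].
Qed.

Lemma ratfun_polyX (a : 'X_{1..#|ray D|}) :
  ratfun_poly ('X_[a] : {mpoly k[#|ray D|]}) = xpow k (mon_degree a).
Proof.
rewrite mpolyXE_id rmorph_prod (reindex (@enum_rank (ray D))) /=; last first.
  exact/onW_bij/enum_rank_bij.
by apply: eq_bigr => r _; rewrite rmorphXn /= ffunE.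
Qed.

Lemma ratfun_polyZ c (p : {mpoly k[#|ray D|]}) :
  ratfun_poly (c *: p) = c *: ratfun_poly p.
Proof. by rewrite ratfun_scaleE -rmorphM mul_mpolyC. Qed.

(** The grading by Z^Delta(1) separates monomials, so each graded piece of S has dimension at most
    one. *)
Lemma homogeneousE e (p : {mpoly k[#|ray D|]}) : homogeneous e p ->
  exists c, ratfun_poly p = c *: xpow k e /\ (c != 0 -> forall r, 0 <= e r).
Proof.
move=> /allP hp; have [->|p0] := eqVneq p 0.
  by exists 0; rewrite rmorph0 scale0r eqxx.
have /eqP pe := hp _ (mlead_supp p0).
have ep : p = p@_(mlead p) *: 'X_[mlead p].
  apply/mpolyP => a; rewrite mcoeffZ mcoeffX.
  have [ap|] := boolP (a \in msupp p); last first.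
    case: eqVneq => [<-|_] /memN_msupp_eq0 ->; last by rewrite mulr0.
    by rewrite mul0r.
  have -> : a = mlead p by apply: mon_degree_inj; rewrite pe; exact/eqP/hp.
  by rewrite eqxx mulr1.
exists p@_(mlead p); split=> [|_ r]; last by rewrite -pe ffunE.
by rewrite {1}ep ratfun_polyZ ratfun_polyX pe.
Qed.

(** Clearing denominators reduces to homogeneous polynomials; only the variables of rays in [s] must
    keep nonnegative exponents. *)
Lemma homog_locE s e q : homog_loc s e q <->
  exists c : k, q = c *: xpow k e /\ (c != 0 -> forall r, r \in s -> 0 <= e r).
Proof.
split=> [/homog_locP [N [p [/homogeneousE [c [ep hc]] eq]]]|[c [-> hc]]].
  exists c; split=> [|/hc {}hc r rs].
    have : q * xpow k (hat_degree s *+ N) =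
        (c *: xpow k e) * xpow k (hat_degree s *+ N).
      by rewrite eq ep xpowD !ratfun_scaleE mulrA.
    by move/(mulIf (xpow_neq0 _ _)).
  by have := hc r; rewrite ffunE ffunMnE ffunE rs mul0rn addr0.
have [->|/hc {}hc] := eqVneq c 0; first by rewrite scale0r; exact: homog_loc0.
exact/homog_locZ/homog_loc_xpow.
Qed.

Lemma scale_xpow_inj e : injective (fun c : k => c *: xpow k e).
Proof.
move=> a b /=; rewrite !ratfun_scaleE => /(mulIf (xpow_neq0 _ _)) /eqP.
by rewrite tofrac_eq mpolyC_eq => /eqP.
Qed.

Lemma scale_xpowM a b e f :
  (a *: xpow k e) * (b *: xpow k f) = (a * b) *: xpow k (e + f).
Proof.
by rewrite !ratfun_scaleE xpowD mulrACA -rmorphM -mpolyCM.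
Qed.

Definition coef e (q : ratfun k #|ray D|) : k :=
  if pselect (exists c, q = c *: xpow k e) is left h then projT1 (cid h) else 0.

Lemma coefE e c : coef e (c *: xpow k e) = c.
Proof.
rewrite /coef; case: pselect => [h|[]]; last by exists c.
by apply: (@scale_xpow_inj e); case: (cid h).
Qed.

Section FreeSheafCoefficients.
Variables (I : finType) (n : I -> degree).
Local Notation sect s m := (free_sect k n s m).

(** In a fixed degree a section amounts to one scalar per summand, unchanged by restriction and by
    characters. *)
Definition sect_coef s m (f : sect s m) i : k :=
  coef (n i + pair_degree D m) (sect_val f i).

Lemma sect_coefE s m (f : sect s m) i :
  sect_val f i = sect_coef f i *: xpow k (n i + pair_degree D m).
Proof.
by have /homog_locE [c [e _]] := sect_loc f i; rewrite /sect_coef e coefE.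
Qed.

Lemma sect_coefP s m (f : sect s m) i c :
  sect_val f i = c *: xpow k (n i + pair_degree D m) -> sect_coef f i = c.
Proof. by move=> e; rewrite /sect_coef e coefE. Qed.

Lemma sect_coef_ge0 s m (f : sect s m) i r :
  sect_coef f i != 0 -> r \in s -> 0 <= n i r + pairing m (gen r).
Proof.
have /homog_locE [c [e hc]] := sect_loc f i.
by rewrite (sect_coefP e) => /hc {}hc /hc; rewrite !ffunE.
Qed.

Lemma sect_coef_inj s m (f g : sect s m) : sect_coef f =1 sect_coef g -> f = g.
Proof. by move=> e; apply: sect_eq => i; rewrite !sect_coefE e. Qed.

Lemma sect_coefL s m a (f g : sect s m) i :
  sect_coef (a *: f + g) i = a * sect_coef f i + sect_coef g i.
Proof.
apply: sect_coefP; rewrite sect_valL [sect_val f i]sect_coefE.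
by rewrite [sect_val g i]sect_coefE scalerA -scalerDl.
Qed.

Lemma sect_coef0 s m i : sect_coef (0 : sect s m) i = 0.
Proof. by apply: sect_coefP; rewrite sect_val0 scale0r. Qed.

Lemma sect_coefZ s m a (f : sect s m) i : sect_coef (a *: f) i = a * sect_coef f i.
Proof. by rewrite -[a *: f]addr0 sect_coefL sect_coef0 addr0. Qed.

Lemma sect_coef_mul s m m' (h : in_dual s (m' - m)) (f : sect s m) i :
  sect_coef (free_mul k n h f) i = sect_coef f i.
Proof.
apply: sect_coefP; rewrite [LHS]free_mulE sect_coefE.
rewrite -[xpow k (pair_degree D (m' - m))]scale1r scale_xpowM mul1r.
by rewrite addrCA pair_degreeB.
Qed.

Lemma sect_coef_build s m (c : I -> k) :
  (forall i r, c i != 0 -> r \in s -> 0 <= n i r + pairing m (gen r)) ->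
  exists f : sect s m, sect_coef f =1 c.
Proof.
move=> hc; have fP : [ffun i => c i *: xpow k (n i + pair_degree D m)]
    \in free_pred n s m.
  apply/asboolP => i; rewrite ffunE; apply/homog_locE; exists (c i).
  by split=> // ci r rs; rewrite !ffunE hc.
by exists (FreeSect fP) => i; apply: sect_coefP; rewrite ffunE.
Qed.

End FreeSheafCoefficients.

Lemma sect_coef_matrix (I J : finType) (n : J -> degree) (n' : I -> degree)
    (A : I -> J -> {mpoly k[#|ray D|]}) (homA : homogeneous_matrix n n' A)
    (B : I -> J -> k) s m (f : free_sect k n s m) i :
  (forall j, ratfun_poly (A i j) = B i j *: xpow k (n' i - n j)) ->
  sect_coef (matrix_sect homA s m f) i = \sum_j B i j * sect_coef f j.
Proof.
move=> hA; apply: sect_coefP; rewrite [LHS]matrixE scaler_suml.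
apply: eq_bigr => j _; rewrite hA sect_coefE scale_xpowM.
by rewrite addrA subrK.
Qed.

End Coefficients.

(** * Twists *)

Section Bilinear.
Variables (R : realType) (d : nat) (D : fan R d) (k : fieldType).
Variables (s : {set ray D}) (P Q W : gmodule k s) (b : gbilin P Q W).

Lemma linear_fun_scale (U V : lmodType k) (f : U -> V) c x :
  linear f -> f (c *: x) = c *: f x.
Proof.
move=> fL; have f0 : f 0 = 0.
  by have := fL (- 1) 0 0; rewrite scaler0 addr0 scaleN1r addNr.
by rewrite -[c *: x]addr0 fL f0 addr0.
Qed.

Lemma bil_scalel m n c (x : P m) (y : Q n) : b m n (c *: x) y = c *: b m n x y.
Proof. exact: linear_fun_scale (bil_linl b y). Qed.

Lemma bil_scaler m n c (x : P m) (y : Q n) : b m n x (c *: y) = c *: b m n x y.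
Proof. exact: linear_fun_scale (bil_linr b x). Qed.

End Bilinear.

Section Twist.
Variables (R : realType) (d : nat) (D : fan R d) (k : fieldType).
Variables (E : eqsheaf D k) (mu : cone D -> 'rV[int]_d) (a : ray D -> int).
Hypothesis muP : forall (s : cone D) r, r \in val s -> pairing (mu s) (gen r) = a r.
Implicit Types (s t : cone D) (m : 'rV[int]_d).

Lemma shift_dual (s : {set ray D}) u m m' :
  in_dual s (m' - m) -> in_dual s (m' + u - (m + u)).
Proof. by rewrite opprD addrACA subrr addr0. Qed.

Lemma transition_dual s t m : val t \subset val s ->
  in_dual (val t) (m + mu t - (m + mu s)).
Proof.
move=> /subsetP ts; apply/forall_inP => r rt.
by rewrite opprD addrACA subrr add0r pairingDl pairingNl !muP ?subrr // ts.
Qed.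

Lemma transition_dualV s t m : val t \subset val s ->
  in_dual (val t) (m + mu s - (m + mu t)).
Proof.
move=> /subsetP ts; apply/forall_inP => r rt.
by rewrite opprD addrACA subrr add0r pairingDl pairingNl !muP ?subrr // ts.
Qed.

(** The twist by O(sum a_r D_r): over U_s this line bundle is free on a generator of degree
    [- mu s], so tensoring shifts the grading by [mu s]. *)
Definition twist_gmodule s : gmodule k (val s).
Proof.
refine (@GModule _ _ D k (val s) (fun m => E s (m + mu s))
  (fun m m' h => gmul (shift_dual (mu s) h)) _ _).
- by move=> m h x; exact: gmul_id.
- by move=> m m' m'' h h' h'' x; exact: gmul_comp.
Defined.

(** The generators for [s] and [t] differ by the character of [mu t - mu s], a unit on U_t by
    [muP]. *)
Definition twist_res s t (h : val t \subset val s) m :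
    {linear twist_gmodule s m -> twist_gmodule t m} :=
  gmul (transition_dual m h) \o res h (m + mu s).

Lemma twist_res_id s (h : val s \subset val s) m (x : twist_gmodule s m) :
  twist_res h m x = x.
Proof. by rewrite /twist_res /= res_id gmul_id. Qed.

Lemma twist_res_comp s t (u : cone D) (h : val t \subset val s)
    (h' : val u \subset val t) (h'' : val u \subset val s) m (x : twist_gmodule s m) :
  twist_res h' m (twist_res h m x) = twist_res h'' m x.
Proof.
rewrite /twist_res /= (res_mul _ _ (in_dualS h' (transition_dual m h))).
by rewrite (res_comp _ _ h'') (gmul_comp _ _ (transition_dual m h'')).
Qed.

Lemma twist_res_mul s t (h : val t \subset val s) m m'
    (g : in_dual (val s) (m' - m)) (g' : in_dual (val t) (m' - m))
    (x : twist_gmodule s m) :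
  twist_res h m' (gmul g x) = gmul g' (twist_res h m x).
Proof.
rewrite /twist_res /= (res_mul _ _ (in_dualS h (shift_dual (mu s) g))).
have g'' : in_dual (val t) (m' + mu t - (m + mu s)).
  rewrite -(subrK (m' + mu s) (m' + mu t)) -addrA in_dualD ?transition_dual //.
  exact: shift_dual.
by rewrite !(gmul_comp _ _ g'').
Qed.

Lemma twist_res_ker s t (h : val t \subset val s) m (x : twist_gmodule s m) :
  twist_res h m x = 0 ->
  exists m' (g : in_dual (val s) (m' - m)),
    (forall r, r \in val t -> pairing (m' - m) (gen r) = 0) /\ gmul g x = 0.
Proof.
(* The transition character is invertible, so the restriction already vanishes in [E]. *)
rewrite /twist_res /= => /(congr1 (gmul (transition_dualV m h))).
rewrite (gmul_comp _ _ (in_dual_refl _ _)) gmul_id linear0.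
move=> /res_ker [m' [g [ort gx]]].
have e : m' - mu s - m = m' - (m + mu s) by rewrite opprD addrA addrAC.
have g1 : in_dual (val s) (m' - mu s - m) by rewrite e.
have g2 : in_dual (val s) (m' - mu s + mu s - m') by rewrite subrK in_dual_refl.
exists (m' - mu s), g1; rewrite e; split=> //=.
by rewrite -(gmul_comp g g2) gx linear0.
Qed.

Lemma twist_res_loc s t (h : val t \subset val s) m (y : twist_gmodule t m) :
  exists m' (g : in_dual (val s) (m' - m)) (g' : in_dual (val t) (m' - m)),
    (forall r, r \in val t -> pairing (m' - m) (gen r) = 0) /\
    exists x : twist_gmodule s m', twist_res h m' x = gmul g' y.
Proof.
have [m' [g [g' [ort [x ex]]]]] := res_loc h (gmul (transition_dualV m h) y).
have e : m' - mu s - m = m' - (m + mu s) by rewrite opprD addrA addrAC.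
have g1 : in_dual (val s) (m' - mu s - m) by rewrite e.
have g2 : in_dual (val s) (m' - mu s + mu s - m') by rewrite subrK in_dual_refl.
exists (m' - mu s), g1, (in_dualS h g1); split=> [r rt|]; first by rewrite e ort.
exists (gmul g2 x); rewrite /twist_res /= (res_mul _ _ (in_dualS h g2)) ex.
have g3 : in_dual (val t) (m' - (m + mu t)).
  by rewrite -(subrK (m + mu s) m') -addrA in_dualD ?transition_dualV.
rewrite (gmul_comp _ _ g3).
have g4 : in_dual (val t) (m' - mu s + mu s - (m + mu t)) by rewrite subrK.
have g5 : in_dual (val t) (m' - mu s + mu t - (m + mu t)).
  by rewrite opprD addrACA subrr addr0 (in_dualS h).
rewrite (gmul_comp _ _ g4) (gmul_comp _ _ g5).
by rewrite (bool_irrelevance g5 (shift_dual (mu t) (in_dualS h g1))).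
Qed.

Definition twist : eqsheaf D k :=
  EqSheaf twist_res_id twist_res_comp twist_res_mul twist_res_ker twist_res_loc.

Lemma emb_twist s t (h : val t \subset val s) m (x : twist s m) :
  emb E t (m + mu t) (res h m x) = emb E s (m + mu s) x.
Proof.
have -> : res h m x = gmul (transition_dual m h) (res h (m + mu s) x) by [].
by rewrite emb_mul emb_res.
Qed.

Definition twisting_sheaf : eqsheaf D k :=
  free_sheaf k (fun _ : unit => [ffun r => a r]).

Lemma sect_coef_dflt s m m' (f : twisting_sheaf s m) i :
  in_dual (val s) (m' - m) -> sect_coef (gmul_dflt m' f) i = sect_coef f i.
Proof. by move=> h; rewrite (gmul_dfltE h) -[RHS](sect_coef_mul h). Qed.

Lemma twisting_generator s :
  exists f : twisting_sheaf s (- mu s), sect_coef f tt = 1.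
Proof.
have [|f ef] := 
    @sect_coef_build _ _ D k unit (fun=> [ffun r => a r]) (val s) (- mu s) (fun=> 1).
  by move=> _ r _ rs; rewrite ffunE pairingNl muP // subrr.
by exists f; rewrite ef.
Qed.

Lemma twisting_dual s m (f : twisting_sheaf s m) :
  sect_coef f tt != 0 -> in_dual (val s) (m + mu s).
Proof.
move=> f0; apply/forall_inP => r rs.
by have := sect_coef_ge0 f0 rs; rewrite ffunE pairingDl muP // addrC.
Qed.

Lemma twisting_sect_eq s m (f g : twisting_sheaf s m) :
  sect_coef f tt = sect_coef g tt -> f = g.
Proof. by move=> e; apply: sect_coef_inj => -[]. Qed.

(** The covering by the single open set [f = 1] suffices: the generator is a basis over the whole
    chart. *)
Lemma twisting_line_bundle : line_bundle twisting_sheaf.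
Proof.
move=> s; have [e e1] := twisting_generator s.
have s1 : in_kdual (val s) (kmono k 0).
  by apply: in_kdual_mono; apply/forall_inP => r _; rewrite pairing0l.
exists [:: (kmono k 0, kmono k 0)]; split.
- by move=> gf; rewrite inE => /eqP ->.
- move=> m; rewrite /kcoef /= big_mkcond big_seq1 /= mulr1 addr0 eq_sym.
  by case: (m == 0).
move=> gf; rewrite inE => /eqP -> /=; exists (fun=> single e).
have ce (f : kpoly d k) m : in_kdual (val s) f ->
    sect_coef (kact f (single e) m : twisting_sheaf s m) tt = kcoef f (m + mu s).
  move=> /allP hf; rewrite /kact /kcoef [RHS]big_mkcond.
  pose F (x : twisting_sheaf s m) := sect_coef x tt.
  have FD : {morph F : x y / x + y}.
    by move=> x y; rewrite /F -[x]scale1r sect_coefL mul1r scale1r.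
  have F0 : F 0 = 0 by exact: sect_coef0.
  rewrite -/(F _) big_seq [RHS]big_seq.
  apply: (big_ind2 (fun x y => F x = y)) => [//|x x' y y' <- <-|t /hf ht];
    first exact: FD.
  rewrite /F sect_coefZ; case: eqP => [tm|ne].
    have -> : m - t.2 = - mu s by rewrite tm opprD addrA subrr add0r.
    by rewrite single_id sect_coef_dflt ?opprK -?tm // e1 mulr1.
  rewrite single_neq ?linear0 ?sect_coef0 ?mulr0 //.
  by apply/eqP => e'; apply: ne; rewrite -[t.2](subKr m) e' opprK.
split=> [_|q [l hl]|f hf f0]; first exact: single_supp.
- pose qc m := sect_coef (q m : twisting_sheaf s m) tt.
  (* The coordinates of [q], read as the polynomial that multiplies [e]; outside of the dual cone
     they are 0. *)
  pose c : kpoly d k :=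
    [seq (qc m, m + mu s) | m <- undup l & in_dual (val s) (m + mu s)].
  exists 0%N, (fun=> c); have hc : in_kdual (val s) c.
    by apply/allP => _ /mapP [m + ->]; rewrite mem_filter => /andP[].
  split=> // m; rewrite big_ord1 /=; apply: twisting_sect_eq; rewrite ce //.
  rewrite /kcoef big_map big_filter_cond /=.
  have [ml|ml] := boolP (m \in l); last first.
    rewrite hl // sect_coef0 big1_seq // => m' /andP[/andP[_ /eqP /addIr ->]].
    by rewrite mem_undup (negPf ml).
  rewrite -/(qc m); have [q0|/twisting_dual ms] := eqVneq (qc m) 0.
    by rewrite q0 big1 // => m' /andP[_ /eqP /addIr ->].
  rewrite (eq_bigl (fun m' => m' == m)) => [|m'].
    by rewrite (big_pred1_seq qc) ?undup_uniq ?mem_undup.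
  by rewrite (inj_eq (addIr _)); case: eqP => [->|]; rewrite ?andbF ?ms.
- exists 0%N => i m /=; have := f0 (m - mu s); rewrite (ord1 i) big_ord1.
  move/(congr1 (fun x : twisting_sheaf s (m - mu s) => sect_coef x tt)).
  by rewrite ce // sect_coef0 subrK.
Qed.

(** * The twist as a tensor product *)

Section TwistTensor.
Variable s : cone D.

Lemma twist_sum_dual m n : in_dual (val s) (n + mu s) ->
  in_dual (val s) (m + n + mu s - m).
Proof. by rewrite -(addrA m n) (addrC m) addrK. Qed.

(** As [f] is its coordinate times chi(n + mu s) times the generator, this character is moved onto
    [x]. If n + mu s is outside of the dual cone, the coordinate is 0 and the default of [gmul_dflt]
    does no harm. *)
Definition twist_fun m n (x : E s m) (f : twisting_sheaf s n) : twist s (m + n) :=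
  sect_coef f tt *: gmul_dflt (m + n + mu s) x.

Lemma twist_linl m n (f : twisting_sheaf s n) :
  linear (fun x : E s m => twist_fun x f).
Proof. by move=> c x y; rewrite /twist_fun linearP scalerDr !scalerA mulrC. Qed.

Lemma twist_linr m n (x : E s m) :
  linear (twist_fun x : twisting_sheaf s n -> twist s (m + n)).
Proof. by move=> c f g; rewrite /twist_fun sect_coefL scalerDl scalerA. Qed.

Lemma twist_funE m n (x : E s m) (f : twisting_sheaf s n) m'
    (h : in_dual (val s) (m' + mu s - m))
    (g : in_dual (val s) (m' - (m + n))) :
  gmul g (twist_fun x f) = sect_coef f tt *: gmul h x :> E s (m' + mu s).
Proof.
rewrite /twist_fun; have [->|/twisting_dual fd] := eqVneq (sect_coef f tt) 0.
  by rewrite !scale0r linear0.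
rewrite linearZ /= (gmul_dfltE (twist_sum_dual m fd)); congr (_ *: _).
exact: gmul_comp.
Qed.

Lemma twist_mull m m' n (h : in_dual (val s) (m' - m))
    (h' : in_dual (val s) (m' + n - (m + n))) (x : E s m) (f : twisting_sheaf s n) :
  twist_fun (gmul h x) f = gmul h' (twist_fun x f).
Proof.
have [f0|f0] := eqVneq (sect_coef f tt) 0.
  by rewrite /twist_fun f0 !scale0r linear0.
have fd := twisting_dual f0.
have g : in_dual (val s) (m' + n + mu s - m).
  by rewrite -(subrK m' (_ + mu s)) -addrA in_dualD // twist_sum_dual.
rewrite (twist_funE _ _ g) /twist_fun (gmul_dfltE (twist_sum_dual m' fd)).
congr (_ *: _); exact: (@gmul_comp _ _ _ _ _ (E s)).
Qed.

Lemma twist_mulr m n n' (h : in_dual (val s) (n' - n))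
    (h' : in_dual (val s) (m + n' - (m + n))) (x : E s m) (f : twisting_sheaf s n) :
  twist_fun x (gmul h f) = gmul h' (twist_fun x f).
Proof.
have ef : sect_coef (gmul h f : twisting_sheaf s n') tt = sect_coef f tt.
  exact: sect_coef_mul.
have [f0|f0] := eqVneq (sect_coef f tt) 0.
  by rewrite /twist_fun ef f0 !scale0r linear0.
have fd := f0; rewrite -ef in fd; have {}fd := twisting_dual fd.
rewrite (twist_funE _ _ (twist_sum_dual m fd)) /twist_fun ef.
by rewrite (gmul_dfltE (twist_sum_dual m fd)).
Qed.

Definition twist_bilin : gbilin (E s) (twisting_sheaf s) (twist s) :=
  GBilin twist_linl twist_linr twist_mull twist_mulr.

(** Each [w] in the twist is the image of [w] tensored with the generator [e], so [c] can only
    factor through w |-> c(w, e). *)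
Lemma twist_is_tensor_product : is_tensor_product twist_bilin.
Proof.
have [e e1] := twisting_generator s.
move=> V c.
(* Identifies the degrees m + mu s - mu s and [m]. *)
have down m : in_dual (val s) (m - (m + mu s + - mu s)).
  by rewrite addrK in_dual_refl.
have hl m : linear (fun x : twist s m => gmul (down m) (c (m + mu s) (- mu s) x e)).
  by move=> b x y; rewrite bil_linl linearP.
pose hm m : {linear twist s m -> V m} :=
  HB.pack (fun x : twist s m => gmul (down m) (c (m + mu s) (- mu s) x e))
    (GRing.isLinear.Build _ _ _ _ _ (hl m)).
have hM m m' (g : in_dual (val s) (m' - m)) (x : twist s m) :
    hm m' (gmul g x) = gmul g (hm m x).
  have g1 : in_dual (val s) (m' + mu s + - mu s - (m + mu s + - mu s)).
    by rewrite !addrK.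
  have g2 : in_dual (val s) (m' - (m + mu s + - mu s)) by rewrite addrK.
  transitivity (gmul (down m') (gmul g1 (c (m + mu s) (- mu s) x e))).
    by rewrite -(bil_mull c (shift_dual (mu s) g)).
  by rewrite (gmul_comp _ _ g2) [hm m x]/= (gmul_comp _ _ g2).
exists (GHom hM); split=> [m n x f|h' hh' m w].
  have bil0 : c m n x 0 = 0 by rewrite -(scale0r 0) bil_scaler scale0r.
  have [f0|f0] := eqVneq (sect_coef f tt) 0.
    have -> : f = 0 by apply: twisting_sect_eq; rewrite f0 sect_coef0.
    transitivity (gmul (down (m + n)) (c (m + n + mu s) (- mu s) (twist_fun x 0) e)).
      by [].
    by rewrite bil0 /twist_fun sect_coef0 bil_scalel scale0r linear0.
  have fd := twisting_dual f0.
  have g : in_dual (val s) (n - - mu s) by rewrite opprK.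
  (* As [f] is a multiple of [e], its character can be moved to the first argument of [c]. *)
  have ef : f = sect_coef f tt *: gmul g e.
    apply: twisting_sect_eq; rewrite sect_coefZ -[LHS]mulr1 -e1; congr (_ * _).
    by apply/esym; exact: sect_coef_mul.
  have g1 : in_dual (val s) (m + n - (m + - mu s)).
    by rewrite opprD addrACA subrr add0r.
  have g2 : in_dual (val s) (m + n + mu s + - mu s - (m + - mu s)) by rewrite addrK.
  rewrite [X in _ = c m n x X]ef bil_scaler (bil_mulr c g g1).
  transitivity (gmul (down (m + n)) (c (m + n + mu s) (- mu s) (twist_fun x f) e)).
    by [].
  rewrite /twist_fun (gmul_dfltE (twist_sum_dual m fd)) bil_scalel linearZ.
  by rewrite (bil_mull c _ g2) (gmul_comp _ _ g1).
transitivity (gmul (down m) (c (m + mu s) (- mu s) w e)); last by [].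
rewrite -hh' -hom_mul; congr (h' m _).
rewrite [RHS](twist_funE _ _ (in_dual_refl _ _)) e1 scale1r.
exact/esym/(@gmul_id _ _ _ _ _ (E s)).
Qed.

End TwistTensor.

Lemma is_twist_twist : is_twist E twist.
Proof.
exists twisting_sheaf; first exact: twisting_line_bundle.
exists twist_bilin; split=> [s|s t h m n x f]; first exact: twist_is_tensor_product.
have ef : sect_coef (res h n f : twisting_sheaf t n) tt = sect_coef f tt by [].
transitivity (twist_res h (m + n) (twist_fun x f)); first by [].
transitivity (twist_fun (res h m x) (res h n f)); last by [].
have [f0|f0] := eqVneq (sect_coef f tt) 0.
  by rewrite /twist_fun ef f0 !scale0r linear0.
have fd := twisting_dual f0; have fd' := in_dualS h fd.
have fe := f0; rewrite -ef in fe; have {}fe := twisting_dual fe.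
rewrite /twist_fun ef linearZ; congr (_ *: _).
rewrite (gmul_dfltE (twist_sum_dual m fd)) (gmul_dfltE (twist_sum_dual m fe)).
rewrite /twist_res /= (res_mul _ _ (in_dualS h (twist_sum_dual m fd))).
exact: (@gmul_comp _ _ _ _ _ (E t)).
Qed.

End Twist.

(** * Linear algebra *)

Section LinearAlgebra.
Variables (k : fieldType) (V : lmodType k).

(** The square matrix expressing [b] through [g] has trivial left kernel, hence is invertible. *)
Lemma independent_span n (b g : 'I_n -> V) :
  (forall c : 'I_n -> k, \sum_i c i *: b i = 0 -> forall i, c i = 0) ->
  (forall v, exists c : 'I_n -> k, v = \sum_i c i *: g i) ->
  forall v, exists c : 'I_n -> k, v = \sum_i c i *: b i.
Proof.
move=> bfree gspan v; have /choice [B hB] i := gspan (b i).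
pose M := \matrix_(i, j) B i j.
have comb (c : 'rV_n) : \sum_i c 0 i *: b i = \sum_j (c *m M) 0 j *: g j.
  under eq_bigr => i _ do rewrite hB scaler_sumr.
  rewrite exchange_big; apply: eq_bigr => j _; rewrite mxE scaler_suml.
  by apply: eq_bigr => i _; rewrite scalerA mxE.
have uM : M \in unitmx.
  rewrite -row_free_unit; apply: inj_row_free => c cM.
  apply/rowP => i; rewrite mxE; apply: bfree.
  by rewrite comb cM big1 // => j _; rewrite mxE scale0r.
have [c ->] := gspan v; exists (fun i => (\row_j c j *m invmx M) 0 i).
by rewrite comb mulmxKV //; apply: eq_bigr => j _; rewrite mxE.
Qed.

(** Relations form the left kernel of the matrix of the [e i] in the basis [b]. It has full column
    rank since the [e i] span, so the kernel has dimension #|I| - p. *)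
Lemma relation_basis (I : finType) p (b : 'I_p -> V) (e : I -> V) :
  (forall c : 'I_p -> k, \sum_i c i *: b i = 0 -> forall i, c i = 0) ->
  (forall v, exists c : 'I_p -> k, v = \sum_i c i *: b i) ->
  (forall v, exists c : I -> k, v = \sum_i c i *: e i) ->
  exists K : I -> 'I_(#|I| - p) -> k,
    (forall c, (forall i, \sum_j K i j * c j = 0) -> forall j, c j = 0) /\
    (forall y : I -> k, \sum_i y i *: e i = 0 <->
       exists c, forall i, y i = \sum_j K i j * c j).
Proof.
move=> bfree bspan espan; have /choice [B hB] i := bspan (e i).
pose W : 'M_(#|I|, p) := \matrix_(i, j) B (enum_val i) j.
pose vec (y : I -> k) : 'rV_#|I| := \row_i y (enum_val i).
have comb y : \sum_i y i *: e i = \sum_j (vec y *m W) 0 j *: b j.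
  under eq_bigr => i _ do rewrite hB scaler_sumr.
  rewrite exchange_big; apply: eq_bigr => j _; rewrite mxE scaler_suml.
  rewrite (reindex (@enum_val I I)) /=; last exact/onW_bij/enum_val_bij.
  by apply: eq_bigr => i _; rewrite scalerA !mxE.
have comb0 y : \sum_i y i *: e i = 0 <-> vec y *m W = 0.
  rewrite comb; split=> [/bfree h|->]; last by apply: big1 => j _;
    rewrite mxE scale0r.
  by apply/rowP => j; rewrite h mxE.
have fullW : row_full W.
  rewrite -sub1mx; apply/row_subP => j; have [c ec] := espan (b j).
  apply/submxP; exists (vec c); apply/rowP => j'; rewrite rowE mulmx1 mxE eqxx /=.
  have /bfree/(_ j')/eqP : \sum_l ((l == j)%:R - (vec c *m W) 0 l) *: b l = 0.
    under eq_bigr do rewrite scalerBl;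
      rewrite sumrB -comb -ec (bigD1 j) //= eqxx scale1r.
    by rewrite big1 ?addr0 ?subrr // => l /negPf ->; rewrite scale0r.
  by rewrite subr_eq0 => /eqP <-.
have rk : \rank (kermx W) = (#|I| - p)%N by rewrite mxrank_ker (eqP fullW).
pose K := castmx (rk, erefl) (row_base (kermx W)).
have KE : (K :=: kermx W)%MS by apply: eqmx_trans (eqmx_cast _ _) (eq_row_base _).
have freeK : row_free K by rewrite row_free_castmx row_base_free.
have vecK (c : 'I_(#|I| - p) -> k) :
    \row_j c j *m K = vec (fun i => \sum_j K j (enum_rank i) * c j).
  by apply/rowP => i; rewrite !mxE enum_valK; apply: eq_bigr => l _;
    rewrite mxE mulrC.
exists (fun i j => K j (enum_rank i)); split=> [c c0 j|y].
  have /eqP : \row_j c j *m K = 0 by rewrite vecK; apply/rowP => i; rewrite !mxE c0.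
  by rewrite mulmx_free_eq0 // => /eqP/rowP/(_ j); rewrite !mxE.
split=> [/comb0/sub_kermxP|[c ec]].
  rewrite -KE => /submxP [c ec]; exists (fun j => c 0 j) => i.
  have := congr1 (fun v : 'rV_#|I| => v 0 (enum_rank i)) ec.
  by rewrite !mxE enum_rankK => ->; apply: eq_bigr => j _; rewrite mulrC.
apply/comb0/sub_kermxP; rewrite -KE; apply/submxP; exists (\row_j c j).
by rewrite vecK; apply/rowP => i; rewrite !mxE ec.
Qed.

End LinearAlgebra.

(** * The exact sequence *)

Section Filtrations.
Variables (R : realType) (D : fan R 2) (k : fieldType) (E : eqsheaf D k).
Variables (i1 i2 : ray D -> int) (L : ray D -> limit_space E -> Prop).
Hypotheses (smD : smooth D) (E2 : vector_bundle 2 E).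
Hypothesis filE : forall r, filtration_is r (i1 r) (i2 r) (L r).
Hypothesis lt12 : forall r, i1 r < i2 r.
Local Notation V := (limit_space E).
Implicit Types (s : cone D) (r : ray D) (v w : V).

Lemma filtration_at r i : exists m, pairing m (gen r) = i.
Proof.
have [m mP] := smooth_functional smD (fun=> i) (ray_in_cones r).
by exists m; apply: mP; exact: set11.
Qed.

Lemma filtration0 r i : filtration r i (0 : V).
Proof.
have [m <-] := filtration_at r i.
by apply/filtrationP; exists 0; rewrite linear0.
Qed.

Lemma filtrationL r i c v w :
  filtration r i v -> filtration r i w -> filtration r i (c *: v + w).
Proof.
have [m <-] := filtration_at r i; move=> /filtrationP [x <-] /filtrationP [y <-].
by apply/filtrationP; exists (c *: x + y); rewrite linearP.
Qed.

Lemma filtrationZ r i c v : filtration r i v -> filtration r i (c *: v).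
Proof.
by move=> rv; rewrite -[_ *: _]addr0; apply: filtrationL => //; exact: filtration0.
Qed.

Lemma filtration_mono r i j v : i <= j -> filtration r i v -> filtration r j v.
Proof.
have [m <-] := filtration_at r i; have [m' <-] := filtration_at r j.
move=> le /filtrationP [x <-]; have g : in_dual (val (ray_cone r)) (m' - m).
  by apply/forall_inP => r'; rewrite inE => /eqP ->;
    rewrite pairingDl pairingNl subr_ge0.
by apply/filtrationP; exists (gmul g x); rewrite emb_mul.
Qed.

(** Local freeness on the torus gives two vectors spanning the limit space; so two independent
    vectors of E^r(i2) span it too. *)
Lemma limit_basis r : exists b : 'I_2 -> V,
  [/\ forall c : 'I_2 -> k, \sum_i c i *: b i = 0 -> forall i, c i = 0,
      forall v, exists c : 'I_2 -> k, v = \sum_i c i *: b i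
    & forall v, filtration r (i2 r) v].
Proof.
have [_ [_ [b [bfree bE]]] _] := filE r.
have [g gspan] := locally_free_span (E2 (zero_cone D)).
have bspan := independent_span bfree gspan.
by exists b; split=> // v; apply/bE; exact: bspan.
Qed.

Lemma filtration_top r i v : i2 r <= i -> filtration r i v.
Proof.
by move=> le; apply: (filtration_mono le); have [b [_ _]] := limit_basis r; apply.
Qed.

Lemma filtration_bot r i v : i < i1 r -> filtration r i v -> v = 0.
Proof.
move=> lt rv; have [[[b [_ bE]] _] _ _] := filE r.
have /(filtration_mono) /(_ rv) /bE [c ->] : i <= i1 r - 1 by lia.
by rewrite big_ord0.
Qed.

Lemma line_generators : exists e : ray D -> V,
  (forall r, e r != 0) /\ (forall r v, L r v <-> exists c, v = c *: e r).
Proof.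
suff /choice [e he] r : exists e : V, e != 0 /\ forall v, L r v <-> exists c, v = c *: e.
  by exists e; split=> r; case: (he r).
have [_ _ /(_ (lt12 r)) [[b [bfree bE]] _]] := filE r; exists (b ord0); split.
  apply/eqP => b0; have := bfree (fun=> 1); rewrite big_ord1 b0 scaler0.
  by move=> /(_ erefl ord0) /eqP; rewrite oner_eq0.
move=> v; rewrite bE; split=> [[c ->]|[c ->]]; first by exists (c ord0);
  rewrite big_ord1.
by exists (fun=> c); rewrite big_ord1.
Qed.

(** * Generators of the lines *)

Variable e : ray D -> V.
Hypothesis e_neq0 : forall r, e r != 0.
Hypothesis LE : forall r v, L r v <-> exists c, v = c *: e r.

Lemma filtration_line r i v : i < i2 r -> filtration r i v ->
  exists c, v = c *: e r.
Proof.
move=> lt rv; have [lt1|ge1] := ltP i (i1 r).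
  by exists 0; rewrite scale0r (filtration_bot lt1 rv).
apply/LE; have [_ _ /(_ (lt12 r)) [_ fL]] := filE r.
by apply/(fL i) => //; rewrite ge1.
Qed.

Lemma filtration_gen r i : i1 r <= i -> filtration r i (e r).
Proof.
move=> ge1; have [lt|] := ltP i (i2 r); last exact: filtration_top.
have [_ _ /(_ (lt12 r)) [_ fL]] := filE r.
have ge : i1 r <= i < i2 r by rewrite ge1.
by apply/(fL i ge)/LE; exists 1; rewrite scale1r.
Qed.

Hypothesis lines_neq : forall r r' : ray D, r != r' ->
  (exists2 s, s \in cones_of_dim D 2 & (r \in s) && (r' \in s)) ->
  ~ (forall v, L r v <-> L r' v).

(** Two distinct rays of one cone make it 2-dimensional, so their lines differ; a nonzero common
    vector would identify them. *)
Lemma lines_meet s r r' c c' : r \in val s -> r' \in val s -> r != r' ->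
  c *: e r = c' *: e r' -> c = 0.
Proof.
move=> rs r's rr' ecc; apply/eqP/negPn/negP => c0.
apply: (lines_neq rr').
  exists (val s); last by rewrite rs r's.
  by apply: (smooth_dim2 smD) rr' => //; exact: valP.
have er : e r = (c^-1 * c') *: e r' by rewrite -scalerA -ecc scalerA mulVf ?scale1r.
have cc0 : c^-1 * c' != 0.
  by apply: contraNneq (e_neq0 r) => cc0; rewrite er cc0 scale0r.
move=> v; rewrite !LE er; split=> [[x ->]|[x ->]].
  by exists (x * (c^-1 * c')); rewrite scalerA.
by exists (x / (c^-1 * c')); rewrite scalerA divfK.
Qed.

Hypothesis cD : complete D.

(** By completeness some cone has two rays, and their two generators already form a basis. *)
Lemma generators_span v : exists c : ray D -> k, v = \sum_r c r *: e r.
Proof.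
have [s0 [r [r' [sD rs r's rr']]]] := complete_cone2 cD.
pose s : cone D := Sub s0 sD.
have ss : val s = s0 by [].
have [b [_ bspan _]] := limit_basis r.
pose f (i : 'I_2) := e (if i == 0 then r else r').
have ffree (c : 'I_2 -> k) : \sum_i c i *: f i = 0 -> forall i, c i = 0.
  rewrite big_ord_recl big_ord1 /f /= => /eqP; rewrite addr_eq0 => /eqP ec.
  have c0 : c 0 = 0.
    by apply: (@lines_meet s r r' (c 0) (- c (lift ord0 ord0)));
      rewrite ?ss // scaleNr.
  have c1 : c (lift ord0 ord0) = 0.
    apply: (@lines_meet s r' r _ 0); rewrite ?ss // 1?eq_sym //.
    by apply/eqP; rewrite -eqr_opp -ec c0 !scale0r oppr0.
  by move=> i; case: (unliftP ord0 i) => [j|] ->; rewrite ?(ord1 j).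
have [c ->] := independent_span ffree bspan v.
exists (fun r0 =>
  if r0 == r then c 0 else if r0 == r' then c (lift ord0 ord0) else 0).
rewrite big_ord_recl big_ord1 (bigD1 r) //= (bigD1 r') 1?eq_sym //= !eqxx eq_sym (negPf rr').
by rewrite big1 ?addr0 // => r0 /andP[/negPf -> /negPf ->]; rewrite scale0r.
Qed.

Lemma cone_card s : (#|val s| <= 2)%N.
Proof. by apply: (smooth_card smD); exact: valP. Qed.

Lemma prime_divisorM r z r' : (prime_divisor r *~ z) r' = (r' == r)%:Z * z.
Proof.
case: z => n; rewrite ?NegzE ?mulrNz ?ffunE -?pmulrn ffunMnE ffunE; case: (r' == r).
- by rewrite mul1r pmulrn mulrzz mul1r.
- by rewrite mul0rn mul0r.
- by rewrite mul1r pmulrn mulrzz mul1r.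
- by rewrite mul0rn mul0r oppr0.
Qed.

(** * The map from the sum of line bundles to the twist *)

Definition gap r : int := i2 r - i1 r.
Local Notation shift := (fun r => prime_divisor r *~ gap r).

Definition image_vector s m (y : free_sect k shift (val s) m) : V :=
  \sum_r sect_coef y r *: e r.

Variable mu : cone D -> 'rV[int]_2.
Hypothesis muP : forall s r, r \in val s -> pairing (mu s) (gen r) = i2 r.

(** A nonzero coordinate at [r'] forces the filtration index to be at least [i1] at the ray [r'] and
    at least [i2] at the other rays of [s]; both terms contain [e r']. The memberships then glue
    over U_s. *)
Lemma image_vector_section s m (y : free_sect k shift (val s) m) :
  exists x : twist E muP s m, emb E s (m + mu s) x = image_vector y.
Proof.
apply: (emb_glue E2 (cone_card s)) => r rs; rewrite pairingDl muP //.
rewrite /image_vector; elim/big_ind: _ => [|v w rv rw|r' _];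
  first exact: filtration0.
  by rewrite -[v]scale1r; exact: filtrationL.
have [->|y0] := eqVneq (sect_coef y r') 0; first by rewrite scale0r;
  exact: filtration0.
apply: filtrationZ; have := sect_coef_ge0 y0 rs; rewrite prime_divisorM.
have [<-|_] := eqVneq r r'; rewrite /gap => h.
  by apply: filtration_gen; lia.
by apply: filtration_top; lia.
Qed.

(** The chosen section is unique as [emb] is injective, whence linearity and compatibility. *)
Definition bundle_fun s m (y : free_sect k shift (val s) m) : twist E muP s m :=
  projT1 (cid (image_vector_section y)).

Lemma emb_bundle_fun s m (y : free_sect k shift (val s) m) :
  emb E s (m + mu s) (bundle_fun y) = image_vector y.
Proof. by rewrite /bundle_fun; case: (cid _). Qed.

Lemma image_vectorL s m c (x y : free_sect k shift (val s) m) :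
  image_vector (c *: x + y) = c *: image_vector x + image_vector y.
Proof.
rewrite /image_vector scaler_sumr -big_split; apply: eq_bigr => r _.
by rewrite sect_coefL scalerDl scalerA.
Qed.

Lemma bundle_fun_linear s m : linear (@bundle_fun s m).
Proof.
move=> c x y; apply: (emb_inj E2 (m := m + mu s)).
by rewrite linearP !emb_bundle_fun image_vectorL.
Qed.

HB.instance Definition _ s m := GRing.isLinear.Build k (free_sect k shift (val s) m)
  (twist E muP s m) _ (@bundle_fun s m) (@bundle_fun_linear s m).

Definition bundle_map : eqmap (free_sheaf k shift) (twist E muP).
Proof.
unshelve refine (@EqMap R 2 D k (free_sheaf k shift) (twist E muP)
  (fun s => @GHom _ _ _ _ _ (free_sheaf k shift s) (twist E muP s)
     (fun m => @bundle_fun s m) _) _).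
- move=> m m' h x; apply: (emb_inj E2 (m := m' + mu s)).
  rewrite [RHS]emb_mul [LHS]emb_bundle_fun [RHS]emb_bundle_fun.
  by apply: eq_bigr => r _; congr (_ *: _); exact: sect_coef_mul.
- move=> s t h m x; apply: (emb_inj E2 (m := m + mu t)).
  by rewrite [RHS]emb_twist [LHS]emb_bundle_fun [RHS]emb_bundle_fun.
Defined.

(** * Relations and exactness *)

Variable K : ray D -> 'I_(#|ray D| - 2) -> k.
Hypothesis K_inj :
  forall c, (forall r, \sum_j K r j * c j = 0) -> forall j, c j = 0.
Hypothesis K_relations : forall y : ray D -> k, \sum_r y r *: e r = 0 <->
  exists c, forall r, y r = \sum_j K r j * c j.

Definition gap_multinom r : 'X_{1..#|ray D|} :=
  [multinom (if i == enum_rank r then `|gap r|%N else 0%N) | i < #|ray D|].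

Lemma gap_gt0 r : 0 < gap r.
Proof. by rewrite subr_gt0. Qed.

Lemma mon_degree_gap r : mon_degree (gap_multinom r) = shift r - 0.
Proof.
apply/ffunP => r'; rewrite subr0 prime_divisorM ffunE mnmE (inj_eq enum_rank_inj).
by case: (r' == r); rewrite ?mul0r // mul1r gtz0_abs ?gap_gt0.
Qed.

Definition relation_matrix r j : {mpoly k[#|ray D|]} :=
  K r j *: 'X_[gap_multinom r].

Lemma relation_matrix_homogeneous :
  homogeneous_matrix (fun _ => 0) shift relation_matrix.
Proof.
move=> r j; apply: homogeneousZ.
by rewrite /homogeneous msuppX /= mon_degree_gap eqxx.
Qed.

Local Notation relation_map := (matrix_map relation_matrix_homogeneous).

Lemma relation_map_coef s m (x : free_sheaf k (fun _ => 0) s m) r :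
  sect_coef (relation_map s m x : free_sect k shift (val s) m) r =
  \sum_j K r j * sect_coef (x : free_sect k (fun _ => 0) (val s) m) j.
Proof.
apply: (sect_coef_matrix relation_matrix_homogeneous x) => j.
by rewrite ratfun_polyZ ratfun_polyX mon_degree_gap.
Qed.

(* A section supported outside of the dual cone lives on a single ray, and no
   nonzero relation does. *)
Lemma image_vector_outside s m (y : free_sect k shift (val s) m) :
  ~~ in_dual (val s) m -> image_vector y = 0 -> sect_coef y =1 fun=> 0.
Proof.
move=> /forall_inPn [r0 r0s]; rewrite -ltNge => m0 y0.
have yr r : r != r0 -> sect_coef y r = 0.
  move=> rr0; apply/eqP/negPn/negP => /sect_coef_ge0 /(_ r0s).
  by rewrite prime_divisorM eq_sym (negPf rr0) mul0r add0r leNgt m0.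
move=> r; have [->|/yr//] := eqVneq r r0.
move: y0; rewrite /image_vector (bigD1 r0) //= big1 => [|r' /yr ->];
  last by rewrite scale0r.
by rewrite addr0 => /eqP; rewrite scaler_eq0 (negPf (e_neq0 r0)) orbF => /eqP.
Qed.

(** In the dual cone all coordinates are admissible and the generators span. Outside, [v] lies on
    the line of one ray, and its only coordinate must be shown admissible. *)
Lemma bundle_map_surj s m (z : twist E muP s m) :
  exists y : free_sect k shift (val s) m, image_vector y = emb E s (m + mu s) z.
Proof.
set v := emb _ _ _ _.
have fv r : r \in val s -> filtration r (pairing m (gen r) + i2 r) v.
  by move=> rs; rewrite -(muP rs) -pairingDl; exact: filtration_emb.
suff [c cv cs] : exists2 c : ray D -> k, v = \sum_r c r *: e r &
    forall r r', c r != 0 -> r' \in val s -> 0 <= shift r r' + pairing m (gen r').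
  have [y yc] := sect_coef_build cs; exists y; rewrite cv.
  by apply: eq_bigr => r _; rewrite yc.
have [ms|/forall_inPn [r0 r0s]] := boolP (in_dual (val s) m).
  have [c cv] := generators_span v; exists c => // r r' _ r's.
  rewrite prime_divisorM addr_ge0 ?(forall_inP ms) // mulr_ge0 // ltW //.
  exact: gap_gt0.
rewrite -ltNge => m0.
have [|c vc] := filtration_line _ (fv _ r0s); first lia.
have [v0|v0] := eqVneq v 0.
  exists (fun=> 0) => [|r r']; last by rewrite eqxx.
  by rewrite v0 big1 // => r _; rewrite scale0r.
have c0 : c != 0 by apply: contraNneq v0 => c0; rewrite vc c0 scale0r.
exists (fun r => if r == r0 then c else 0) => [|r r'].
  rewrite (bigD1 r0) //= eqxx big1 ?addr0 // => r /negPf ->.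
  by rewrite scale0r.
case: (eqVneq r r0) => [-> _ r's|]; last by rewrite eqxx.
(* At [r0], a failure would put [v] in a term below [i1], which is zero. *)
rewrite prime_divisorM; have [->|r'0] := eqVneq r' r0.
  rewrite mul1r leNgt; apply/negP; rewrite /gap => lt; move: v0.
  by rewrite (filtration_bot _ (fv _ r0s)) ?eqxx //; lia.
(* At another ray of [s], a failure would put [v] on a second, different line. *)
rewrite mul0r add0r leNgt; apply/negP => lt.
have [|c' vc'] := filtration_line _ (fv _ r's); first lia.
have := c0; rewrite (lines_meet r0s r's _ (etrans (esym vc) vc')) ?eqxx //.
by rewrite eq_sym.
Qed.

Lemma bundle_map_exact : short_exact relation_map bundle_map.
Proof.
move=> s m.
have bundle0 (y : free_sect k shift (val s) m) :
    bundle_map s m y = 0 <-> image_vector y = 0.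
  rewrite -emb_bundle_fun; split=> [y0|y0].
    by rewrite -[RHS](linear0 (emb E s (m + mu s))); congr (emb _ _ _ _).
  by apply: (emb_inj E2 (m := m + mu s)); rewrite linear0 -[RHS]y0.
split=> [x x0|y|z].
- apply: sect_coef_inj => j; rewrite sect_coef0.
  apply: (K_inj (c := sect_coef x)) => r.
  by rewrite -relation_map_coef x0 sect_coef0.
- rewrite bundle0; split=> [y0|[x <-]]; last first.
    by apply/K_relations; exists (sect_coef x) => r; exact: relation_map_coef.
  have [c yc] := (K_relations _).1 y0.
  (* The coordinates [c] are admissible in O^(n-2): if [m] is outside of the dual cone, then [y] is
     zero, and so is [c]. *)
  have [|x xc] := @sect_coef_build _ _ D k _ (fun=> 0) (val s) m c.
    move=> j r cj rs; rewrite ffunE add0r.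
    have [ms|ms] := boolP (in_dual (val s) m); first exact: (forall_inP ms).
    move: cj; rewrite (K_inj (c := c)) ?eqxx // => r'.
    by rewrite -yc image_vector_outside.
  exists x; apply: sect_coef_inj => r; rewrite relation_map_coef yc.
  by apply: eq_bigr => j _; rewrite xc.
- have [y yz] := bundle_map_surj z; exists y.
  by apply: (emb_inj E2 (m := m + mu s)); rewrite -yz emb_bundle_fun.
Qed.

End Filtrations.

Theorem theorem6p1 (R : realType) (k : closedFieldType) (D : fan R 2)
    (E : eqsheaf D k)
    (i1 i2 : ray D -> int) (L : ray D -> limit_space E -> Prop) :
  smooth D -> complete D ->
  vector_bundle 2 E ->
  (forall r, filtration_is r (i1 r) (i2 r) (L r)) ->
  (forall r, i1 r < i2 r) ->
  (forall r r' : ray D, r != r' ->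
     (exists2 s, s \in cones_of_dim D 2 & (r \in s) && (r' \in s)) ->
     ~ (forall v, L r v <-> L r' v)) ->
  exists2 E' : eqsheaf D k, is_twist E E' &
    exists (i : ray D -> int)
      (A : ray D -> 'I_(#|ray D| - 2) -> {mpoly k[#|ray D|]}),
      [/\ forall r, 0 < i r,
          forall r j, is_monomial (A r j)
        & exists (homA : homogeneous_matrix (fun _ => 0)
                   (fun r => prime_divisor r *~ i r) A)
                 (g : eqmap (free_sheaf k (fun r => prime_divisor r *~ i r))
                   E'),
            short_exact (matrix_map homA) g].
Proof.
move=> smD cD E2 filE lt12 neqL.
have [e [e0 LE]] := line_generators filE lt12.
(* Local equations of the divisor with coefficients [i2]; twisting by it moves all upper jumps to
   0. *)
have /choice [mu muP] (s : cone D) :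
    exists m, forall r, r \in val s -> pairing m (gen r) = i2 r.
  by apply: (smooth_functional smD); exact: valP.
have espan := generators_span smD E2 filE e0 LE neqL cD.
have [_ [r0 _]] := complete_cone2 cD.
have [b [bfree bspan _]] := limit_basis E2 filE r0.
have [K [Kinj Krel]] := relation_basis bfree bspan espan.
exists (twist E muP); first exact: is_twist_twist.
exists (gap i1 i2), (relation_matrix i1 i2 K); split.
- by move=> r; exact: gap_gt0.
- by move=> r j; exists (K r j), (gap_multinom i1 i2 r).
exists (relation_matrix_homogeneous lt12 K).
exists (bundle_map smD E2 filE lt12 LE muP).
exact: bundle_map_exact.
Qed.
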